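(* Let $X$ be a real separable Hilbert space and let $\mu=\mathcal N(0,Q_\mu)$, $\nu=\mathcal N(0,Q_\nu)$ be centered Gaussian measures on $X$ with Cameron–Martin spaces $H_\mu$ and $H_\nu$. If $T\in\mathscr L(H_\mu,H_\nu)$ and $\|T\|_{\mathscr L(H_\mu,H_\nu)}\le1$, then for every $p\in[1,\infty)$ the operator $\Gamma_{\nu,\mu}(T)$, defined on $\mathscr E(X)$ by the integral formula in the context, extends to a linear continuous operator from $L^p(X,\mu)$ into $L^p(X,\nu)$ with norm equal to $1$.
   Context: For $\gamma=\mathcal N(0,Q_\gamma)$, the Cameron–Martin space is $H_\gamma=Q_\gamma^{1/2}(X)$ with $\langle h,k\rangle_{H_\gamma}=\langle Q_\gamma^{-1/2}h,Q_\gamma^{-1/2}k\rangle_X$, where $Q_\gamma^{-1/2}h$ is the unique $z\in(\ker Q_\gamma^{1/2})^\perp$ with $Q_\gamma^{1/2}z=h$. For $T\in\mathscr L(H_\mu,H_\nu)$ let $(f_k)$ be an orthonormal basis (finite or countable) of $(\ker Q_\mu)^\perp$ consisting of eigenvectors of $Q_\mu$ and let $\pi_m$ be the orthogonal projection of $X$ onto $\mathrm{span}\{f_1,\dots,f_m\}\subseteq H_\mu$. $T_\infty^{\nu,\mu}$ is the limit (it exists) of $T\pi_m$ in $L^2(X,\mu;X)$, for which a version that is linear on $X$ and measurable with respect to the $\mu$-completion of the Borel $\sigma$-algebra is fixed; $T_\infty^\mu:=T_\infty^{\mu,\mu}$. $\mathscr E(X)$ is the set of measurable $f:X\to\mathbb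 R$ for which there are $M,c>0$ with $|f(x)|\le Me^{c\|x\|_X}$ for all $x\in X$. For $\|T\|_{\mathscr L(H_\mu,H_\nu)}\le1$ and $f\in\mathscr E(X)$, $$(\Gamma_{\nu,\mu}(T)f)(x)=\int_Xf\big[(T^\star)_\infty^{\mu,\nu}x+((I-T^\star T)^{1/2})_\infty^\mu y\big]\mu(dy),\qquad x\in X,$$ where $T^\star\in\mathscr L(H_\nu,H_\mu)$ is the adjoint of $T$ and $I$ is the identity of $H_\mu$. *)

(* Defs.v *)
From HB Require Import structures.
From mathcomp Require Import all_boot all_order all_algebra sesquilinear.
From mathcomp Require Import all_classical all_reals all_analysis.
From mathcomp Require Import measurable_realfun.

Set Implicit Arguments.
Unset Strict Implicit.
Unset Printing Implicit Defensive.

Import Order.TTheory GRing.Theory Num.Theory.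
Import numFieldNormedType.Exports.

Local Open Scope classical_set_scope.
Local Open Scope ring_scope.

Notation borel X := (g_sigma_algebraType (@open X)).

Definition separable (X : topologicalType) : Prop :=
  exists2 D : set X, countable D & dense D.

(* A linear subspace of [X] with an inner product of its own, in general not
   that of [X]. Operators between such spaces are total functions [X -> X] whose
   values off the domain's carrier are irrelevant. *)
Record hspace (R : realType) (X : lmodType R) := HSpace {
  carrier : set X;
  ip : X -> X -> R
}.

Section operators.
Context {R : realType} {X : lmodType R}.
Implicit Types (H K : hspace X) (A D T : X -> X).

Definition hnorm H (h : X) : R := Num.sqrt (ip H h h).

Definition opnorm H K T : \bar R :=
  ereal_sup [set (hnorm K (T h))%:E | h in [set h | carrier H h /\ hnorm H h <= 1]].

Definition bounded_op H K T : Prop :=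
  [/\ forall h, carrier H h -> carrier K (T h),
      forall a h k, carrier H h -> carrier H k ->
        T (a *: h + k) = a *: T h + T k
    & (opnorm H K T < +oo)%E].

Definition adjoint_op H K T Tstar : Prop :=
  bounded_op K H Tstar /\
  forall h k, carrier H h -> carrier K k -> ip K (T h) k = ip H h (Tstar k).

Definition positive_op H A : Prop :=
  [/\ bounded_op H H A,
      forall h k, carrier H h -> carrier H k ->
        ip H (A h) k = ip H h (A k)
    & forall h, carrier H h -> 0 <= ip H (A h) h].

Definition sqrt_op H A D : Prop :=
  positive_op H D /\ forall h, carrier H h -> D (D h) = A h.

End operators.

Section gaussian.
Context {R : realType} {X : completeNormedModType R}.
Variable dot : {dot X for idfun}.
Implicit Types (Q S T L : X -> X) (e : nat -> X).

Definition whole : hspace X := HSpace setT dot.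

(* [mu] is N(0, Q): the Fourier transform of [mu] at [h] is
   [exp (- <Q h, h> / 2)]; the two integrals are its real and imaginary parts. *)
Definition centered_gaussian (mu : probability (borel X) R) Q : Prop :=
  positive_op whole Q /\
  forall h : X,
    \int[mu]_x cos (dot h x) = expR (- (dot (Q h) h / 2)) /\
    \int[mu]_x sin (dot h x) = 0.

Definition ker_perp S : set X :=
  [set x | forall w, S w = 0 -> dot x w = 0].

Definition pinv S (h : X) : X :=
  xget 0 [set z | ker_perp S z /\ S z = h].

(* The Cameron-Martin space of N(0, Q), where [S] is the square root of [Q]. *)
Definition cameron_martin S : hspace X :=
  HSpace (range S) (fun h k => dot (pinv S h) (pinv S k)).

Definition proj e (m : nat) (x : X) : X := \sum_(k < m) dot x (e k) *: e k.

(* An orthonormal basis of [ker_perp Q] made of eigenvectors of [Q]; a finite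
   basis is encoded as a sequence that is 0 from some index on. *)
Definition eigenbasis Q e : Prop :=
  [/\ (forall i j, i != j -> dot (e i) (e j) = 0),
      (forall k, e k = 0 \/ dot (e k) (e k) = 1) /\
      (forall k, e k = 0 -> e k.+1 = 0),
      forall k, exists a : R, Q (e k) = a *: e k,
      forall k, ker_perp Q (e k)
    & forall x, ker_perp Q x -> proj e m x @[m --> \oo] --> x].

(* [L] is a version of the limit of [T \o proj e m] in L^2(X, mu; X), linear on
   [X] and measurable for the completion of the Borel sigma-algebra. The
   integral is that of [mu] on the Borel sets: as the supremum of the integrals
   of the simple functions below the integrand, it agrees with the integral
   against the completion for an integrand measurable for the completion. *)
Definition linear_version (mu : probability (borel X) R) e T L : Prop :=
  [/\ forall a x y, L (a *: x + y) = a *: L x + L y,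
      measurable_fun setT
        (L : g_sigma_algebraType
               (completed_algebra_gen (mu : set (borel X) -> \bar R)) ->
             borel X)
    & (\int[mu]_x (`|T (proj e m x) - L x| ^+ 2)%:E)%E @[m --> \oo] --> 0%E].

Definition exp_growth (f : X -> R) : Prop :=
  measurable_fun setT (f : borel X -> R) /\
  exists M c : R, [/\ 0 < M, 0 < c & forall x, `|f x| <= M * expR (c * `|x|)].

(* [y |-> f (A x + B y)] is only measurable for the completion of [mu]; see
   [linear_version] for the meaning of its integral. *)
Definition Gamma (mu : probability (borel X) R) (A B : X -> X)
    (f : X -> R) (x : X) : R :=
  \int[mu]_y f (A x + B y).

End gaussian.

Section Lp_operators.
Context d1 d2 (T1 : measurableType d1) (T2 : measurableType d2) (R : realType).
Variables (mu : {measure set T1 -> \bar R}) (nu : {measure set T2 -> \bar R}).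
Variables (p : \bar R) (p1 : (1 <= p)%E).
Implicit Types G : LfunType mu p1 -> LfunType nu p1.

(* A linear map between the spaces of classes modulo a.e. equality. *)
Definition Lp_linear G : Prop :=
  (forall f g : LfunType mu p1, f = g %[ae mu] -> G f = G g %[ae nu]) /\
  (forall (a : R) (f g : LfunType mu p1),
     G (a *: f + g) = a *: G f + G g %[ae nu]).

Definition Lp_opnorm G : \bar R :=
  ereal_sup [set 'N[nu]_p[EFin \o G f] | f in
    [set f : LfunType mu p1 | ('N[mu]_p[EFin \o f] <= 1)%E]]%E.

End Lp_operators.

(* Main.v *)
Require Import Defs.
From HB Require Import structures.
From mathcomp Require Import all_boot all_order all_algebra sesquilinear.
From mathcomp Require Import all_classical all_reals all_analysis.
From mathcomp Require Import measurable_realfun.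
From mathcomp Require Import ring lra.
Set Implicit Arguments.
Unset Strict Implicit.
Unset Printing Implicit Defensive.
Import Order.TTheory GRing.Theory Num.Theory.
Import numFieldNormedType.Exports.
Local Open Scope classical_set_scope.
Local Open Scope ring_scope.

(** The law of [(x, y) |-> A x + B y] under [nu \x mu] is [mu], where [A] and
    [B] are the extensions of [T^*] and [(I - T^* T)^(1/2)]: its characteristic
    function at [h] is [exp (- (|T Q h|^2 + |(I - T^* T)^(1/2) Q h|^2) / 2)],
    with [Q] the covariance of [mu] and the norms those of [H_nu] and [H_mu],
    and the two squares add up to [|Q h|^2 = <Q h, h>].  By Jensen's inequality
    and Fubini's theorem the integral formula then contracts the p-th norms,
    and the function [1] shows that its norm is [1].

    A finite measure is determined by its characteristic function because the
    bounded functions by which one may multiply without telling the two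
    measures apart form an algebra closed under bounded pointwise limits: it
    contains the cosines of the functionals, hence the signs of their sines,
    hence the signs of the functionals themselves.

    Functions of exponential growth are p-integrable by Fernique's argument:
    the rotation by [pi / 4] preserves [mu \x mu], which bounds the tail at
    [s + sqrt 2 * t] by the square of the tail at [t], up to a constant. *)

(** * Bounded measurable functions *)

Section bounded_measurable.
Context {R : realType} d {T : measurableType d}.
Implicit Types (m : probability T R) (u v : T -> R).

Definition bounded_measurable u : Prop :=
  measurable_fun setT u /\ exists M, forall x, `|u x| <= M.

Lemma bounded_measurable_cst (c : R) : bounded_measurable (fun=> c).
Proof. by split; [exact: measurable_cst | exists `|c|]. Qed.

Lemma bounded_measurableD u v : bounded_measurable u -> bounded_measurable v ->
  bounded_measurable (fun x => u x + v x).
Proof.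
move=> [mu [M uM]] [mv [N vN]]; split; first exact: measurable_funD.
by exists (M + N) => x; rewrite (le_trans (ler_normD _ _))// lerD.
Qed.

Lemma bounded_measurableM u v : bounded_measurable u -> bounded_measurable v ->
  bounded_measurable (fun x => u x * v x).
Proof.
move=> [mu [M uM]] [mv [N vN]]; split; first exact: measurable_funM.
by exists (M * N) => x; rewrite normrM ler_pM.
Qed.

Lemma bounded_measurable_cos u : measurable_fun setT u ->
  bounded_measurable (fun x => cos (u x)).
Proof.
move=> mu; split; last first.
  by exists 1 => x; rewrite ler_norml cos_geN1 cos_le1.
by apply: measurableT_comp mu; apply: continuous_measurable_fun;
  exact: continuous_cos.
Qed.

Lemma bounded_measurable_sin u : measurable_fun setT u ->
  bounded_measurable (fun x => sin (u x)).
Proof.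
move=> mu; split; last first.
  by exists 1 => x; rewrite ler_norml sin_geN1 sin_le1.
by apply: measurableT_comp mu; apply: continuous_measurable_fun;
  exact: continuous_sin.
Qed.

Lemma bounded_measurable_integrable m u : bounded_measurable u ->
  m.-integrable setT (EFin \o u).
Proof.
move=> [mu [M uM]]; apply: measurable_bounded_integrable => //.
  by rewrite (le_lt_trans (probability_le1 m measurableT))// ltry.
exists M; split; first exact: num_real.
by move=> N MN x _; rewrite /= (le_trans (uM x))// ltW.
Qed.

Lemma cvg_Rintegral_bounded m (u_ : nat -> T -> R) u (M : R) :
  (forall n, measurable_fun setT (u_ n)) -> (forall n x, `|u_ n x| <= M) ->
  (forall x, u_ n x @[n --> \oo] --> u x) ->
  \int[m]_x u_ n x @[n --> \oo] --> \int[m]_x u x.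
Proof.
move=> mu_ uM uu.
have mu : measurable_fun setT u by exact: measurable_fun_cvg mu_ _.
have Mfin : m.-integrable setT (EFin \o cst M).
  exact/bounded_measurable_integrable/bounded_measurable_cst.
have mEu_ n : measurable_fun setT (EFin \o u_ n) by exact/measurable_EFinP.
have mEu : measurable_fun setT (EFin \o u) by exact/measurable_EFinP.
have Euu : {ae m, forall x, setT x -> (EFin \o u_ n) x @[n --> \oo] --> (EFin \o u) x}.
  by apply: aeW => x _; apply/fine_cvgP; split; [exact: nearW|exact: uu].
have EuM : {ae m, forall x n, setT x -> (`|(EFin \o u_ n) x| <= (EFin \o cst M) x)%E}.
  by apply: aeW => x n _; rewrite lee_fin.
have [iu _ cu] := dominated_convergence measurableT mEu_ mEu Euu Mfin EuM.
apply: fine_cvg; rewrite /Rintegral fineK//.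
exact: integrable_fin_num.
Qed.
End bounded_measurable.

(** * Uniqueness of the Fourier transform *)

Section sign_iteration.
Context {R : realType}.

(* The odd cubic [(3 s - s^3) / 2] has attracting fixed points [-1] and [1] and
   the repelling fixed point [0], so that its iterates, which are polynomials,
   converge to the sign function on [[-1, 1]] while staying bounded by [1]. *)
Definition sign_step (s : R) : R := 3 / 2 * s + - (1 / 2) * (s * (s * s)).

Lemma iter_sign_stepN n (s : R) :
  iter n sign_step (- s) = - iter n sign_step s.
Proof. by elim: n => //= n ->; rewrite /sign_step; field. Qed.

(** One step multiplies the defect [1 - t] by [(1 - t) (2 + t) / 2 = 1 - (t + t^2) / 2], which is at
    most [1 - s / 2] as long as [t >= s]. *)
Lemma iter_sign_step_gt0 n (s : R) : 0 < s -> s <= 1 ->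
  s <= iter n sign_step s <= 1 /\ 1 - iter n sign_step s <= (1 - s / 2) ^+ n.
Proof.
move=> s0 s1; elim: n => /= [|n [/andP[]]].
  by rewrite lexx s1 expr0; split => //; lra.
set t := iter n sign_step s => st t1 IH.
have t0 : 0 < t by exact: lt_le_trans st.
have tt : 1 - sign_step t = (1 - t) * ((1 - t) * (2 + t) / 2).
  by rewrite /sign_step; field.
have fact_le : (1 - t) * (2 + t) / 2 <= 1 - s / 2.
  by rewrite ler_pdivrMr//; nra.
have fact_ge0 : 0 <= (1 - t) * (2 + t) / 2.
  by rewrite divr_ge0// mulr_ge0//; lra.
split.
  apply/andP; split; last first.
    by rewrite -subr_ge0 tt mulr_ge0// subr_ge0.
  have -> : sign_step t = t + t * (1 - t * t) / 2 by rewrite /sign_step; field.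
  rewrite (le_trans st)// lerDl divr_ge0// mulr_ge0 ?(ltW t0)//; nra.
rewrite tt exprSr; apply: ler_pM => //; lra.
Qed.

Lemma cvg_iter_sign_step (s : R) : `|s| <= 1 ->
  iter n sign_step s @[n --> \oo] --> Num.sg s.
Proof.
have pos (t : R) : 0 < t -> t <= 1 -> iter n sign_step t @[n --> \oo] --> (1 : R).
  move=> t0 t1.
  have cX : 1 - (1 - t / 2) ^+ n @[n --> \oo] --> (1 : R).
    rewrite -[X in _ --> X]subr0; apply: cvgB; first exact: cvg_cst.
    by apply: cvg_expr; rewrite ger0_norm; lra.
  have sq : \forall n \near \oo, 1 - (1 - t / 2) ^+ n <= iter n sign_step t <= 1.
    apply: nearW => n; have [/andP[_ t1n] h] := iter_sign_step_gt0 n t0 t1.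
    by rewrite t1n andbT lerBlDl addrC -lerBlDl.
  by apply: (squeeze_cvgr sq cX); exact: cvg_cst.
rewrite ler_norml => /andP[s1 s1']; case: (ltgtP s 0) => s0.
- rewrite ltr0_sg//.
  have -> : (fun n => iter n sign_step s) = (fun n => - iter n sign_step (- s)).
    by apply/funext => n; rewrite iter_sign_stepN opprK.
  by apply: cvgN; apply: pos; lra.
- by rewrite gtr0_sg//; exact: pos.
- rewrite s0 sgr0; have -> : (fun n => iter n sign_step 0) = fun=> (0 : R).
    by apply/funext; elim=> //= n ->; rewrite /sign_step; field.
  exact: cvg_cst.
Qed.

Lemma iter_sign_step_bounded n (s : R) : `|s| <= 1 -> `|iter n sign_step s| <= 1.
Proof.
have pos (t : R) : 0 < t -> t <= 1 -> `|iter n sign_step t| <= 1.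
  move=> t0 t1; have [/andP[h h'] _] := iter_sign_step_gt0 n t0 t1.
  by rewrite ger0_norm// (le_trans (ltW t0)).
rewrite ler_norml => /andP[s1 s1']; case: (ltgtP s 0) => s0.
- by rewrite -(opprK s) iter_sign_stepN normrN pos//; lra.
- exact: pos.
- rewrite s0; suff -> : iter n sign_step 0 = 0 :> R by rewrite normr0.
  by elim: n {pos} => //= n ->; rewrite /sign_step; field.
Qed.

(** For fixed [t] the argument eventually lies in [(-pi, pi)], where sine has the sign of its
    argument. *)
Lemma cvg_sgr_sin_div (t : R) :
  Num.sg (sin (n.+1%:R^-1 * t)) @[n --> \oo] --> Num.sg t.
Proof.
have pos (u : R) : 0 < u ->
    \forall n \near \oo, sin (n.+1%:R^-1 * u) > 0.
  move=> u0; near=> n; apply: sin_gt0_pi; rewrite mulr_gt0//=.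
  have nu : u <= n.+1%:R.
    rewrite (@le_trans _ _ n%:R)// ?ler_nat//.
    by near: n; exact: nbhs_infty_ger.
  rewrite (@le_lt_trans _ _ 1)//; last first.
    by rewrite (@lt_le_trans _ _ 2)// ?ltr1n// pi_ge2.
  by rewrite mulrC ler_pdivrMr// mul1r.
case: (ltgtP t 0) => t0.
- apply: cvg_near_cst; near=> n.
  have n0 : 0 < sin (n.+1%:R^-1 * - t).
    by near: n; apply: pos; rewrite oppr_gt0.
  by rewrite !ltr0_sg//; move: n0; rewrite mulrN sinN oppr_gt0.
- apply: cvg_near_cst; near=> n; rewrite !gtr0_sg//.
  by near: n; exact: pos.
- by rewrite t0 sgr0; under eq_fun do rewrite mulr0 sin0 sgr0; exact: cvg_cst.
Unshelve. all: by end_near. Qed.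

End sign_iteration.

(** * Measures with the same cosine integrals *)

Section fourier_uniqueness.
Context {R : realType} d {T : measurableType d} (m1 m2 : probability T R).
Variable F : set (T -> R).
Hypothesis measurable_F : forall f, F f -> measurable_fun setT f.
Hypothesis linear_F : forall (a : R) f g, F f -> F g -> F (fun x => a * f x + g x).
Hypothesis cst_F : forall c : R, F (fun=> c).
Hypothesis generating_F : forall G : set_system T, sigma_algebra setT G ->
  (forall f, F f -> G [set x | 0 < f x]) -> measurable `<=` G.
Hypothesis cos_F : forall f, F f -> \int[m1]_x cos (f x) = \int[m2]_x cos (f x).

Let indistinct (u : T -> R) : Prop := bounded_measurable u /\
  forall g, F g -> \int[m1]_x (u x * cos (g x)) = \int[m2]_x (u x * cos (g x)).

(** Multipliers compose, so they form an algebra, which is not evident for the class [indistinct]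
    itself. Since [1] is indistinct, every multiplier is indistinct as well. *)
Let multiplier (v : T -> R) : Prop := bounded_measurable v /\
  forall u, indistinct u -> indistinct (fun x => u x * v x).

Let F_scale (a : R) f : F f -> F (fun x => a * f x).
Proof.
move=> Ff; have := linear_F a Ff (cst_F 0).
by under eq_fun do rewrite addr0.
Qed.

Let F_add f g : F f -> F g -> F (fun x => f x + g x).
Proof.
by move=> Ff Fg; have := linear_F 1 Ff Fg; under eq_fun do rewrite mul1r.
Qed.

Let indistinct1 : indistinct (fun=> 1).
Proof.
split=> [|g Fg]; first exact: bounded_measurable_cst.
by under eq_Rintegral do rewrite mul1r; under [RHS]eq_Rintegral do rewrite mul1r;
  exact: cos_F.
Qed.

Let indistinct_lin a u v : indistinct u -> indistinct v ->
  indistinct (fun x => a * u x + v x).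
Proof.
move=> [bu Iu] [bv Iv]; split.
  apply: bounded_measurableD => //.
  by apply: bounded_measurableM => //; exact: bounded_measurable_cst.
move=> g Fg.
have bc := bounded_measurable_cos (measurable_F Fg).
have E (m : probability T R) : \int[m]_x ((a * u x + v x) * cos (g x)) =
    a * \int[m]_x (u x * cos (g x)) + \int[m]_x (v x * cos (g x)).
  under eq_Rintegral do rewrite mulrDl -mulrA.
  rewrite RintegralD//.
  - by rewrite RintegralZl//; exact/bounded_measurable_integrable/bounded_measurableM.
  - apply/bounded_measurable_integrable/bounded_measurableM.
      exact: bounded_measurable_cst.
    exact: bounded_measurableM.
  - exact/bounded_measurable_integrable/bounded_measurableM.
by rewrite !E Iu// Iv.
Qed.

Let indistinct_cvg (u_ : nat -> T -> R) (u : T -> R) (M : R) :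
  (forall n x, `|u_ n x| <= M) ->
  (forall x, u_ n x @[n --> \oo] --> u x) ->
  (forall n, indistinct (u_ n)) -> indistinct u.
Proof.
move=> uM uu Iu.
have mu_ n : measurable_fun setT (u_ n) by case: (Iu n) => -[].
have mu : measurable_fun setT u by exact: measurable_fun_cvg mu_ _.
split.
  split => //; exists M => x.
  have cu : `|u_ n x| @[n --> \oo] --> `|u x| by apply: cvg_norm; exact: uu.
  rewrite -(cvg_lim _ cu)//; apply: limr_le; last exact: nearW.
  by apply/cvg_ex; exists `|u x|.
move=> g Fg; have [mc _] := bounded_measurable_cos (measurable_F Fg).
have cv (m : probability T R) : \int[m]_x (u_ n x * cos (g x)) @[n --> \oo] -->
    \int[m]_x (u x * cos (g x)).
  apply: (@cvg_Rintegral_bounded _ _ _ _ _ _ M).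
  - by move=> n; exact: measurable_funM.
  - move=> n x; rewrite normrM -[leRHS]mulr1 ler_pM//.
    by rewrite ler_norml cos_geN1 cos_le1.
  - by move=> x; apply: cvgM; [exact: uu|exact: cvg_cst].
have := cv m1.
have -> : (fun n => \int[m1]_x (u_ n x * cos (g x))) =
          (fun n => \int[m2]_x (u_ n x * cos (g x))).
  by apply/funext => n; case: (Iu n) => _ /(_ g Fg).
by move=> cv1; exact: cvg_unique cv1 (cv m2).
Qed.

Let multiplier_cvg (u_ : nat -> T -> R) (u : T -> R) (M : R) :
  (forall n x, `|u_ n x| <= M) ->
  (forall x, u_ n x @[n --> \oo] --> u x) ->
  (forall n, multiplier (u_ n)) -> multiplier u.
Proof.
move=> uM uu Mu.
have key w : indistinct w -> indistinct (fun x => w x * u x).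
  move=> Iw; have [[_ [N wN]] _] := Iw.
  apply: (@indistinct_cvg (fun n x => w x * u_ n x) _ (N * M)).
  - by move=> n x; rewrite normrM ler_pM.
  - by move=> x; apply: cvgM; [exact: cvg_cst|exact: uu].
  - by move=> n; case: (Mu n) => _; exact.
split => //; have [+ _] := key _ indistinct1.
by under eq_fun do rewrite mul1r.
Qed.

Let multiplier_cst c : multiplier (fun=> c).
Proof.
split; first exact: bounded_measurable_cst.
(* [c * u] is written as [(c - 1) * u + u], a combination of functions already known to be
   indistinct. *)
move=> u Iu; have := indistinct_lin (c - 1) Iu Iu.
by congr indistinct; apply/funext => x; ring.
Qed.

Let multiplierD u v : multiplier u -> multiplier v ->
  multiplier (fun x => u x + v x).
Proof.
move=> [bu Mu] [bv Mv]; split; first exact: bounded_measurableD.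
move=> w Iw; have := indistinct_lin 1 (Mu _ Iw) (Mv _ Iw).
by congr indistinct; apply/funext => x; ring.
Qed.

Let multiplierM u v : multiplier u -> multiplier v ->
  multiplier (fun x => u x * v x).
Proof.
move=> [bu Mu] [bv Mv]; split; first exact: bounded_measurableM.
move=> w Iw; have := Mv _ (Mu _ Iw).
by congr indistinct; apply/funext => x; ring.
Qed.

(** [cos f * cos g] is the mean of [cos (f + g)] and [cos (g - f)], and [F] contains both
    arguments. *)
Let multiplier_cos f : F f -> multiplier (fun x => cos (f x)).
Proof.
move=> Ff; have bf := bounded_measurable_cos (measurable_F Ff); split => // u.
move=> [bu Iu]; split; first exact: bounded_measurableM.
move=> g Fg.
have FD : F (fun x => f x + g x) by exact: F_add.
have FB : F (fun x => - 1 * f x + g x) by exact: linear_F.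
have E (m : probability T R) : \int[m]_x (u x * cos (f x) * cos (g x)) =
    2^-1 * (\int[m]_x (u x * cos (f x + g x)) +
            \int[m]_x (u x * cos (- 1 * f x + g x))).
  have bD := bounded_measurable_cos (measurable_F FD).
  have bB := bounded_measurable_cos (measurable_F FB).
  have i1 : m.-integrable setT (EFin \o (fun x => u x * cos (f x + g x))).
    exact/bounded_measurable_integrable/bounded_measurableM.
  have i2 : m.-integrable setT (EFin \o (fun x => u x * cos (- 1 * f x + g x))).
    exact/bounded_measurable_integrable/bounded_measurableM.
  rewrite -RintegralD// -RintegralZl//; last first.
    apply/bounded_measurable_integrable/bounded_measurableD;
      exact: bounded_measurableM.
  by apply: eq_Rintegral => x _; rewrite !cosD mulN1r cosN sinN; field.
by rewrite !E !Iu.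
Qed.

(** Sine is cosine shifted by [pi / 2], and [F] contains the constants. *)
Let multiplier_sin f : F f -> multiplier (fun x => sin (f x)).
Proof.
move=> Ff; have := multiplier_cos (F_add Ff (cst_F (- (pi / 2)))).
congr multiplier; apply/funext => x.
by rewrite cosD cosN sinN cos_pihalf sin_pihalf; ring.
Qed.

(** The iterates of [sign_step] are polynomials in [sin h], hence multipliers, and tend to the sign
    of [sin h]. With [h = f / (n + 1)], these signs tend in turn to the sign of [f]. *)
Let multiplier_sg f : F f -> multiplier (fun x => Num.sg (f x)).
Proof.
move=> Ff.
have step h : F h -> multiplier (fun x => Num.sg (sin (h x))).
  move=> Fh.
  have sin1 x : `|sin (h x)| <= 1 by rewrite ler_norml sin_geN1 sin_le1.
  apply: (@multiplier_cvg (fun n x => iter n sign_step (sin (h x))) _ 1).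
  - by move=> n x; exact: iter_sign_step_bounded.
  - by move=> x; exact: cvg_iter_sign_step.
  - elim=> [|n IH]; first exact: multiplier_sin.
    by apply: multiplierD; apply: multiplierM => //; try exact: multiplier_cst;
      apply: multiplierM => //; apply: multiplierM.
apply: (@multiplier_cvg (fun n x => Num.sg (sin (n.+1%:R^-1 * f x))) _ 1).
- by move=> n x; rewrite normr_sg lern1 leq_b1.
- by move=> x; exact: cvg_sgr_sin_div.
- by move=> n; exact/step/F_scale.
Qed.

Let indicM : set_system T := [set E | multiplier (\1_E : T -> R)].

(** Complements and intersections come from the algebra of multipliers, countable unions from finite
    ones by a bounded pointwise limit. *)
Let sigma_algebra_indicM : sigma_algebra setT indicM.
Proof.
have compl E : indicM E -> indicM (~` E).
  rewrite /indicM/= => ME.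
  have := multiplierD (multiplier_cst 1) (multiplierM (multiplier_cst (- 1)) ME).
  congr multiplier; apply/funext => x; rewrite !indicE in_setC.
  by case: (x \in E) => /=; ring.
have inter E E' : indicM E -> indicM E' -> indicM (E `&` E').
  rewrite /indicM/= => ME ME'; have := multiplierM ME ME'.
  congr multiplier; apply/funext => x; rewrite !indicE in_setI.
  by case: (x \in E); case: (x \in E') => /=; ring.
split.
- by rewrite /indicM/= indic0; exact: multiplier_cst.
- by move=> E; rewrite setTD; exact: compl.
- move=> A MA.
  have MU n : indicM (\big[setU/set0]_(i < n) A i).
    elim: n => [|n IH]; first by rewrite big_ord0 /indicM/= indic0; exact: multiplier_cst.
    rewrite big_ord_recr/= -[X in indicM X]setCK setCU.
    by apply: (compl); apply: inter; exact: (compl).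
  apply: (@multiplier_cvg (fun n => \1_(\big[setU/set0]_(i < n) A i)) _ 1) => //.
    by move=> n x; rewrite indicE normr_nat lern1 leq_b1.
  move=> x; apply: cvg_near_cst.
  have [[k _ Akx]|nA] := pselect ((\bigcup_k A k) x).
    near=> n; rewrite !indicE !mem_set//; first by exists k.
    rewrite -bigcup_mkord; exists k => //=.
    by near: n; exact: nbhs_infty_gt.
  near=> n; rewrite !indicE !memNset// -bigcup_mkord => -[k _ Akx].
  by apply: nA; exists k.
Unshelve. all: by end_near. Qed.

Lemma fourier_unique E : measurable E -> m1 E = m2 E.
Proof.
move=> mE.
have : indicM E.
  apply: (generating_F sigma_algebra_indicM) => // f Ff; rewrite /indicM/=.
  have Mf := multiplier_sg Ff.
  (* The indicator of [0 < f] is [(sg f + (sg f)^2) / 2]. *)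
  have := multiplierM (multiplier_cst 2^-1) (multiplierD Mf (multiplierM Mf Mf)).
  congr multiplier; apply/funext => x; rewrite indicE.
  have -> : (x \in [set x | 0 < f x]) = (0 < f x) by apply/idP/idP; rewrite inE.
  case: (ltgtP (f x) 0) => f0 /=.
  - by rewrite ltr0_sg//; ring.
  - by rewrite gtr0_sg//; field.
  - by rewrite f0 sgr0; ring.
(* The multiplier [\1_E] applied to [1] and tested against [cos 0 = 1] gives the two masses of
   [E]. *)
case=> _ /(_ _ indistinct1)[_ /(_ _ (cst_F 0))].
under eq_Rintegral do rewrite cos0 mulr1 mul1r.
under [RHS]eq_Rintegral do rewrite cos0 mulr1 mul1r.
rewrite /Rintegral !integral_indic// !setIT => h.
by rewrite -[LHS]fineK ?fin_num_measure// -[RHS]fineK ?fin_num_measure// h.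
Qed.

End fourier_uniqueness.

(** * Inner products and the Borel sigma-algebra *)

Section dot_theory.
Context {R : realType} {X : completeNormedModType R}.
Variable dot : {dot X for idfun}.
Hypothesis norm_dot : forall x : X, `|x| = Num.sqrt (dot x x).
Implicit Types x y z : X.

Lemma dotC x y : dot x y = dot y x.
Proof. by rewrite (@hermC R false idfun X dot) expr0 mul1r. Qed.

Lemma dotDr x y z : dot x (y + z) = dot x y + dot x z.
Proof. exact: raddfD. Qed.

Lemma dotZr a x y : dot x (a *: y) = a * dot x y.
Proof. exact: linearZ. Qed.

Lemma dotDl x y z : dot (x + y) z = dot x z + dot y z.
Proof. by rewrite dotC dotDr !(dotC z). Qed.

Lemma dotZl a x y : dot (a *: x) y = a * dot x y.
Proof. by rewrite dotC dotZr dotC. Qed.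

Lemma dotNr x y : dot x (- y) = - dot x y.
Proof. by rewrite -scaleN1r dotZr mulN1r. Qed.

Lemma dotNl x y : dot (- x) y = - dot x y.
Proof. by rewrite dotC dotNr dotC. Qed.

Lemma dotBr x y z : dot x (y - z) = dot x y - dot x z.
Proof. by rewrite dotDr dotNr. Qed.

Lemma dotBl x y z : dot (x - y) z = dot x z - dot y z.
Proof. by rewrite dotDl dotNl. Qed.

Lemma dot0r x : dot x 0 = 0.
Proof. by rewrite -(scale0r 0) dotZr mul0r. Qed.

Lemma dot0l x : dot 0 x = 0.
Proof. by rewrite dotC dot0r. Qed.

Lemma dot_sumr x (I : Type) (r : seq I) (P : pred I) (f : I -> X) :
  dot x (\sum_(i <- r | P i) f i) = \sum_(i <- r | P i) dot x (f i).
Proof.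
by elim/big_rec2: _ => [|i y1 y2 _ <-]; rewrite ?dot0r ?dotDr.
Qed.

Lemma dot_suml x (I : Type) (r : seq I) (P : pred I) (f : I -> X) :
  dot (\sum_(i <- r | P i) f i) x = \sum_(i <- r | P i) dot (f i) x.
Proof. by rewrite dotC dot_sumr; under eq_bigr do rewrite dotC. Qed.

Lemma dot_gt0 x : x != 0 -> 0 < dot x x.
Proof. exact: neq0_dnorm_gt0. Qed.

Lemma dot_ge0 x : 0 <= dot x x.
Proof. by have [->|/dot_gt0/ltW//] := eqVneq x 0; rewrite dot0r. Qed.

Lemma dot_eq0 x : dot x x = 0 -> x = 0.
Proof.
by move=> x0; apply/eqP/negPn/negP => /dot_gt0; rewrite x0 ltxx.
Qed.

Lemma dot_norm x : dot x x = `|x| ^+ 2.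
Proof. by rewrite norm_dot sqr_sqrtr// dot_ge0. Qed.

Lemma cauchy_schwarz x y : `|dot x y| <= `|x| * `|y|.
Proof.
have [->|y0] := eqVneq y 0; first by rewrite dot0r !normr0 mulr0.
have yy := dot_gt0 y0.
have := dot_ge0 (dot y y *: x - dot x y *: y).
rewrite dotBl !dotBr !dotZl !dotZr (dotC y x) => h.
have {h} : 0 <= dot y y * (dot x x * dot y y - dot x y ^+ 2).
  by rewrite (le_trans h)// le_eqVlt; apply/orP; left; apply/eqP; ring.
rewrite pmulr_rge0// subr_ge0 !dot_norm -exprMn -real_normK ?num_real//.
by rewrite ler_pXn2r// nnegrE// mulr_ge0.
Qed.

Lemma dot_continuous x : continuous (dot x : X -> R).
Proof.
move=> y; apply/cvgrPdist_lt => e e0.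
have x1 : 0 < `|x| + 1 by rewrite ltr_wpDl.
near=> z; rewrite -dotBr (le_lt_trans (cauchy_schwarz _ _))//.
rewrite (@le_lt_trans _ _ ((`|x| + 1) * `|y - z|))//.
  by rewrite ler_wpM2r// lerDl.
rewrite mulrC -ltr_pdivlMr//.
by near: z; apply: cvgr_dist_lt => //; rewrite divr_gt0.
Unshelve. all: by end_near. Qed.

Lemma continuous_measurable_borel (f : X -> R) : continuous f ->
  measurable_fun setT (f : borel X -> R).
Proof.
move=> /continuousP cf; apply: (measurability _ (RGenOpens.measurableE R)).
move=> _ [_ [a [b ->] <-]]; rewrite setTI.
by apply: sub_sigma_algebra; exact/cf/interval_open.
Qed.

Lemma measurable_dot x : measurable_fun setT (dot x : borel X -> R).
Proof. by apply: continuous_measurable_borel; exact: dot_continuous. Qed.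

Lemma measurable_norm : measurable_fun setT (fun x : borel X => `|x : X|).
Proof. by apply: continuous_measurable_borel => x; exact: norm_continuous. Qed.

Hypothesis sepX : separable X.

Lemma dense_sequence : exists s : nat -> X,
  forall x (e : R), 0 < e -> exists i, `|x - s i| < e.
Proof.
have [D /countable_injP[g] gi dD] := sepX.
have D0 : exists a, D a.
  have [|a [_ Da]] := dD setT _ openT; last by exists a.
  by exists 0.
(* [s] inverts the injection [g] of [D] into the integers; an index outside its image is sent to
   some fixed point of [D]. *)
pose s n := xget (projT1 (cid D0)) [set x | D x /\ g x = n].
exists s => x e e0.
have [|a [xa Da]] := dD (ball x e) _ (ball_open _ _).
  by exists x; exact: ballxx.
exists (g a); have -> : s (g a) = a.
  rewrite /s; case: xgetP => [y _ [Dy gy]|/(_ a)/=].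
    by apply: gi; rewrite ?inE.
  by move=> h; exfalso; exact: h.
by move: xa; rewrite -ball_normE.
Qed.

(** The closed balls have their centres in a dense sequence and radii [1 / (j + 1)], and are coded
    by pairs of integers; a code of no pair gives the empty set. Open sets are thus reduced to
    countably many balls chosen in advance. *)
Lemma open_bigcup_balls : exists C : nat -> set X,
  (forall k, C k = set0 \/ exists a r, 0 < r /\ C k = [set x | `|x - a| <= r]) /\
  forall U, open U -> U = \bigcup_(k in [set k | C k `<=` U]) C k.
Proof.
have [s ds] := dense_sequence.
exists (fun k => if unpickle k is Some (i, j)
  then [set x | `|x - s i| <= j.+1%:R^-1] else set0); split.
  move=> k; case: (unpickle k) => [[i j]|]; [right|by left].
  by exists (s i), j.+1%:R^-1; rewrite invr_gt0.
move=> U oU; apply/seteqP; split=> [x Ux|x [k /= kU]]; last exact: kU.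
have /nbhs_ballP[e /= e0 eU] : nbhs x U by exact: open_nbhs_nbhs.
have [j je] : exists j : nat, j.+1%:R^-1 < e / 2.
  have e2 : 0 < e / 2 by rewrite divr_gt0.
  have [N _ HN] := near_infty_natSinv_lt (PosNum e2).
  by exists N; apply: HN => /=.
have [i xi] := ds x j.+1%:R^-1 ltac:(by rewrite invr_gt0).
exists (pickle (i, j)); rewrite /= pickleK; last exact: ltW.
move=> z /= zi; apply: eU; rewrite -ball_normE /=.
rewrite (splitr e) -(subrKA (s i)) (le_lt_trans (ler_normD _ _))// ltrD//.
  exact: lt_trans je.
by rewrite distrC (le_lt_trans zi).
Qed.

(** By [open_bigcup_balls] closed balls suffice, and a closed ball is cut out by countably many
    half-spaces: [|x - a| <= r] as soon as [<s n, x - a> <= r |s n|] for every term of a dense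
    sequence. *)
Lemma borel_generated_by_dot (G : set_system X) : sigma_algebra setT G ->
  (forall h a, G [set x | 0 < dot h x + a]) ->
  (@measurable _ (borel X)) `<=` G.
Proof.
move=> [G0 GC GU] Gdot.
have GN E : G E -> G (~` E) by move=> /GC; rewrite setTD.
have GI (A : nat -> set X) : (forall n, G (A n)) -> G (\bigcap_n A n).
  by move=> GA; rewrite -[X in G X]setCK setC_bigcap; apply/GN/GU => n; exact/GN.
have [s ds] := dense_sequence.
have Gball a r : 0 < r -> G [set x | `|x - a| <= r].
  move=> r0.
  have -> : [set x | `|x - a| <= r] =
      \bigcap_n ~` [set x | 0 < dot (s n) x + (- dot (s n) a - r * `|s n|)].
    apply/seteqP; split=> [x /= xa n _ /=|x /= h].
      apply/negP; rewrite -leNgt addrA subr_le0 -dotBr.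
      rewrite (le_trans (ler_norm _))// (le_trans (cauchy_schwarz _ _))//.
      by rewrite mulrC ler_wpM2r.
    rewrite leNgt; apply/negP => xr; set y := x - a in xr.
    have y0 : 0 < `|y| by exact: lt_trans xr.
    (* With [d = |y - s i|], the half-space of [s i] gives [|y|^2 <= r (|y| + d) + |y| d], which
       fails once [d (r + |y|) < |y| (|y| - r)]; the number is half of that threshold. *)
    have e0 : 0 < `|y| * (`|y| - r) / (2 * (r + `|y|)).
      apply: divr_gt0; apply: mulr_gt0 => //; first by rewrite subr_gt0.
      exact: addr_gt0.
    have [i yi] := ds y _ e0.
    have := h i I => /= /negP; rewrite -leNgt addrA subr_le0 -dotBr -/y => hi.
    clearbody y.
    have sy : `|s i| <= `|y| + `|y - s i|.
      rewrite -[X in `|X| <= _](subKr y).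
      by have /le_trans := ler_normB y (y - s i); apply.
    have : dot y y <= r * (`|y| + `|y - s i|) + `|y| * `|y - s i|.
      have -> : dot y y = dot (s i) y + dot y (y - s i).
        by rewrite dotBr (dotC y (s i)) addrC subrK.
      apply: lerD.
        by rewrite (le_trans hi)// ler_wpM2l// ltW.
      by rewrite (le_trans (ler_norm _))// cauchy_schwarz.
    rewrite dot_norm leNgt => /negP; apply.
    move: yi; rewrite ltr_pdivlMr; last by apply: mulr_gt0 => //; exact: addr_gt0.
    move=> yi; nra.
  apply: GI => n; exact/GN/Gdot.
apply: smallest_sub => // U oU.
have [C [Cball /(_ U oU) ->]] := open_bigcup_balls.
rewrite bigcup_mkcond; apply: GU => k; case: ifPn => // _.
by have [->//|[a [r [r0 ->]]]] := Cball k; exact: Gball.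
Qed.

(** Pettis' theorem for a separable Hilbert space: the half-spaces generate the Borel sets, so weak
    measurability is enough. *)
Lemma measurable_into_borel d (T : measurableType d) (f : T -> X) :
  (forall h, measurable_fun setT (fun t => dot h (f t))) ->
  measurable_fun setT (f : T -> borel X).
Proof.
move=> mf _ E mE; rewrite setTI.
pose G : set_system X := [set E | measurable (f @^-1` E)].
suff : G E by [].
apply: borel_generated_by_dot mE.
  split; rewrite /G/=.
  - by rewrite preimage_set0.
  - by move=> A mA; rewrite setTD preimage_setC; exact: measurableC.
  - by move=> A mA; rewrite preimage_bigcup; exact: bigcupT_measurable.
move=> h a; rewrite /G /=.
have mfa : measurable_fun setT (fun t => dot h (f t) + a).
  exact: measurable_funD.
have := mfa measurableT `]0, +oo[%classic (measurable_itv _).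
by rewrite setTI; congr measurable; apply/seteqP; split => t /=;
  rewrite in_itv/= andbT.
Qed.

End dot_theory.

(** * Characteristic functions *)

Section fourier_law.
Context {R : realType} d1 d2 {T1 : measurableType d1} {T2 : measurableType d2}.
Variables (m1 : probability T1 R) (m2 : probability T2 R) (g : T1 -> T2).
Hypothesis mg : measurable_fun setT g.
Variable F : set (T2 -> R).
Hypothesis measurable_F : forall f, F f -> measurable_fun setT f.
Hypothesis linear_F : forall (a : R) f g, F f -> F g -> F (fun x => a * f x + g x).
Hypothesis cst_F : forall c : R, F (fun=> c).
Hypothesis generating_F : forall G : set_system T2, sigma_algebra setT G ->
  (forall f, F f -> G [set x | 0 < f x]) -> measurable `<=` G.
Hypothesis cos_F : forall f, F f ->
  \int[m1]_x cos (f (g x)) = \int[m2]_x cos (f x).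

Lemma fourier_law E : measurable E -> m1 (g @^-1` E) = m2 E.
Proof.
pose g' : {mfun T1 >-> T2} := HB.pack g (isMeasurableFun.Build _ _ _ _ _ mg).
move=> mE; rewrite -[LHS]/(distribution m1 g' E).
apply: (@fourier_unique _ _ _ (distribution m1 g') m2 F) => // f Ff.
rewrite -cos_F// /Rintegral; congr fine.
have bf := bounded_measurable_cos (measurable_F Ff).
rewrite integral_distribution//; first exact/measurable_EFinP/bf.1.
apply: (@bounded_measurable_integrable _ _ _ m1 (fun x => cos (f (g x)))).
exact/bounded_measurable_cos/(measurableT_comp (measurable_F Ff)).
Qed.

Lemma ge0_integral_fourier_law (f : T2 -> \bar R) :
  measurable_fun setT f -> (forall x, (0 <= f x)%E) ->
  (\int[m1]_x f (g x) = \int[m2]_x f x)%E.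
Proof.
move=> mf f0.
have := ge0_integral_pushforward mg m1 measurableT mf (fun y _ => f0 y).
rewrite preimage_setT => /= <-.
by apply: eq_measure_integral => A mA _; exact: fourier_law.
Qed.

End fourier_law.

(** * Cosine transforms of products and of mean square limits *)

Section cos_transform.
Context {R : realType}.

(* The phase [a] makes one real identity carry the real and the imaginary part
   of the characteristic function [c], which is real for a centered Gaussian. *)
Definition cos_transform d (T : measurableType d) (m : probability T R)
    (g : T -> R) (c : R) : Prop :=
  measurable_fun setT g /\ forall a, \int[m]_x cos (g x + a) = c * cos a.

(** When the second variable is integrated first, the value [f x + a] acts as the phase of [g]; this
    uses that the phase in [cos_transform] is arbitrary. *)
Lemma cos_transform_prod d1 d2 (T1 : measurableType d1) (T2 : measurableType d2)
    (m1 : probability T1 R) (m2 : probability T2 R) f g c1 c2 :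
  cos_transform m1 f c1 -> cos_transform m2 g c2 ->
  cos_transform (m1 \x m2)%E (fun z => f z.1 + g z.2) (c1 * c2).
Proof.
move=> [mf c_f] [mg c_g].
have mfg : measurable_fun setT (fun z : T1 * T2 => f z.1 + g z.2).
  apply: measurable_funD.
    by apply: (measurableT_comp mf); exact: measurable_fst.
  by apply: (measurableT_comp mg); exact: measurable_snd.
split => // a.
have bfg : bounded_measurable (fun z : T1 * T2 => cos (f z.1 + g z.2 + a)).
  by apply: bounded_measurable_cos; exact: measurable_funD.
have ifg := @bounded_measurable_integrable _ _ _ (m1 \x m2)%E _ bfg.
rewrite /Rintegral -(integral12_prod_meas1 ifg) /fubini_F.
have inner x : (\int[m2]_y (EFin \o (fun z => cos (f z.1 + g z.2 + a))%R) (x, y)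
    = (c2 * cos (f x + a))%:E)%E.
  rewrite -c_g fineK /=; last first.
    apply: integrable_fin_num => //; apply: bounded_measurable_integrable.
    by apply: bounded_measurable_cos; exact: measurable_funD.
  by apply: eq_integral => y _ /=; congr ((cos _)%:E); ring.
under eq_integral do rewrite inner.
rewrite -/(Rintegral m1 setT (fun x => c2 * cos (f x + a))) RintegralZl//.
  by rewrite c_f mulrCA mulrA.
apply: bounded_measurable_integrable.
by apply: bounded_measurable_cos; exact: measurable_funD.
Qed.

Lemma cos_lipschitz (a b : R) : `|cos a - cos b| <= `|a - b|.
Proof.
wlog ab : a b / a <= b.
  move=> H; have [/H//|/ltW/H] := leP a b.
  by rewrite distrC (distrC b).
have dcos x : x \in `]a, b[%R -> is_derive x 1 cos (- sin x).
  by move=> _; exact: is_derive_cos.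
have ccos : {within `[a, b], continuous (cos : R -> R)}.
  by apply: continuous_subspaceT => x; exact: continuous_cos.
have [c _ h] := MVT_segment ab dcos ccos.
rewrite distrC h normrM distrC -[leRHS]mul1r ler_wpM2r//.
by rewrite normrN ler_norml sin_geN1 sin_le1.
Qed.

(** Cosine is 1-Lipschitz, so mean square convergence of the functions forces convergence of the
    integrals of their cosines. *)
Lemma cos_transform_cvg d (T : measurableType d) (m : probability T R)
    (g_ : nat -> T -> R) (g : T -> R) (c_ : nat -> R) (c : R) :
  (forall n, cos_transform m (g_ n) (c_ n)) -> measurable_fun setT g ->
  c_ n @[n --> \oo] --> c ->
  (\int[m]_x ((g_ n x - g x) ^+ 2)%:E)%E @[n --> \oo] --> 0%E ->
  cos_transform m g c.
Proof.
move=> cg mg cc gg; split => // a.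
have bg : bounded_measurable (fun x => cos (g x + a)).
  by apply: bounded_measurable_cos; exact: measurable_funD.
have bg_ n : bounded_measurable (fun x => cos (g_ n x + a)).
  by apply: bounded_measurable_cos; apply: measurable_funD => //; case: (cg n).
have c1 : \int[m]_x cos (g_ n x + a) @[n --> \oo] --> c * cos a.
  under eq_fun do rewrite (proj2 (cg _)).
  by apply: cvgM => //; exact: cvg_cst.
suff c2 : \int[m]_x cos (g_ n x + a) @[n --> \oo] --> \int[m]_x cos (g x + a).
  exact: cvg_unique c2 c1.
apply/cvgrPdist_le => e e0.
have e2 : 0 < e / 2 by rewrite divr_gt0.
(* The bound [e^2] makes [e / 2 + e^2 / (2 e)] equal to [e]. *)
have small : \forall n \near \oo,
    (\int[m]_x ((g_ n x - g x) ^+ 2)%:E <= (e ^+ 2)%:E)%E.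
  have [fing /cvgrPdist_le cg0] := (fine_cvgP _ _).1 gg.
  have ee : 0 < e ^+ 2 by rewrite exprn_gt0.
  near=> n.
  have fn : (\int[m]_x ((g_ n x - g x) ^+ 2)%:E)%E \is a fin_num by near: n.
  have : `|0 - fine (\int[m]_x ((g_ n x - g x) ^+ 2)%:E)%E| <= e ^+ 2.
    by near: n; exact: cg0.
  rewrite sub0r normrN ger0_norm ?fine_ge0//; last first.
    by apply: integral_ge0 => x _; rewrite lee_fin sqr_ge0.
  by rewrite -lee_fin fineK.
near=> n.
have sn : (\int[m]_x ((g_ n x - g x) ^+ 2)%:E <= (e ^+ 2)%:E)%E by near: n.
have mgn : measurable_fun setT (g_ n) by case: (cg n).
rewrite -RintegralB//; [|exact: bounded_measurable_integrable..].
have bB : bounded_measurable (fun x => cos (g x + a) - cos (g_ n x + a)).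
  apply: bounded_measurableD => //.
  have := bounded_measurableM (@bounded_measurable_cst _ _ T (- 1)) (bg_ n).
  by under eq_fun do rewrite mulN1r.
rewrite (le_trans (le_normr_Rintegral _ _))//.
  exact: bounded_measurable_integrable.
have absB : m.-integrable setT
    (EFin \o (fun x => `|cos (g x + a) - cos (g_ n x + a)|)).
  exact/integrable_norm/bounded_measurable_integrable.
rewrite -lee_fin fineK ?integrable_fin_num//.
(* [t <= e / 2 + t^2 / (2 e)] turns the quadratic mean into a first moment. *)
apply: (@le_trans _ _ (\int[m]_x
    ((e / 2)%:E + (2 * e)^-1%:E * ((g_ n x - g x) ^+ 2)%:E))%E).
  apply: ge0_le_integral => //=.
  - exact: measurable_int absB.
  - apply/measurable_EFinP; apply: measurable_funD => //.
    by apply: measurable_funM => //; apply: measurable_funX; exact: measurable_funB.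
  - move=> x _; rewrite lee_fin (le_trans (cos_lipschitz _ _))//.
    have -> : g x + a - (g_ n x + a) = g x - g_ n x by ring.
    rewrite distrC; set t := g_ n x - g x.
    have -> : t ^+ 2 = `|t| ^+ 2 by rewrite real_normK ?num_real.
    rewrite -subr_ge0.
    have -> : e / 2 + (2 * e)^-1 * `|t| ^+ 2 - `|t| = (2 * e)^-1 * (`|t| - e) ^+ 2.
      by field; rewrite gt_eqF.
    by rewrite mulr_ge0 ?sqr_ge0// invr_ge0 mulr_ge0// ltW.
have msq : measurable_fun setT (fun x => ((g_ n x - g x) ^+ 2)%:E).
  by apply/measurable_EFinP; apply: measurable_funX; exact: measurable_funB.
rewrite ge0_integralD//=.
- rewrite ge0_integralZl_EFin//; last 2 first.
  + by move=> x _; rewrite lee_fin sqr_ge0.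
  + by rewrite invr_ge0 mulr_ge0// ltW.
  rewrite integral_cst//= [X in (_ * X + _)%E](_ : _ = 1%E); last first.
    exact: probability_setT.
  rewrite mule1.
  have -> : e%:E = ((e / 2)%:E + (2 * e)^-1%:E * (e ^+ 2)%:E)%E.
    by rewrite -EFinM -EFinD; congr EFin; field; rewrite gt_eqF.
  rewrite leeD2l// lee_pmul2l// lte_fin invr_gt0 mulr_gt0//.
- by move=> x _; rewrite lee_fin ltW.
- by move=> x _; rewrite -EFinM lee_fin mulr_ge0 ?sqr_ge0// invr_ge0 mulr_ge0// ltW.
- by apply: emeasurable_funM => //; exact: measurable_cst.
Unshelve. all: by end_near. Qed.

End cos_transform.

(** * Identification of a Gaussian law *)

Section gaussian_law.
Context {R : realType} {X : completeNormedModType R}.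
Variable dot : {dot X for idfun}.
Hypothesis norm_dot : forall x : X, `|x| = Num.sqrt (dot x x).
Hypothesis sepX : separable X.
Variables (mu : probability (borel X) R) (Q : X -> X).
Hypothesis mu_gauss : centered_gaussian dot mu Q.

Lemma centered_gaussian_cos_transform h :
  cos_transform mu (dot h) (expR (- (dot (Q h) h / 2))).
Proof.
have md := measurable_dot norm_dot h.
split=> // a; have [_ /(_ h)[ic is_]] := mu_gauss.
have bc := bounded_measurable_integrable mu (bounded_measurable_cos md).
have bs := bounded_measurable_integrable mu (bounded_measurable_sin md).
under eq_Rintegral do rewrite cosD.
rewrite RintegralB//.
- by rewrite !RintegralZr// ic is_ mul0r subr0.
- apply/bounded_measurable_integrable/bounded_measurableM;
    [exact: bounded_measurable_cos|exact: bounded_measurable_cst].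
- apply/bounded_measurable_integrable/bounded_measurableM;
    [exact: bounded_measurable_sin|exact: bounded_measurable_cst].
Qed.

(** The uniqueness theorem is used with the affine functionals [x |-> <h, x> + a], whose positivity
    sets are the half-spaces that generate the Borel sets. *)
Lemma gaussian_law d (T : measurableType d) (m : probability T R) (g : T -> X) :
  (forall h, cos_transform m (fun t => dot h (g t)) (expR (- (dot (Q h) h / 2)))) ->
  forall f : borel X -> \bar R,
    measurable_fun setT f -> (forall x, (0 <= f x)%E) ->
    (\int[m]_t f (g t) = \int[mu]_x f x)%E.
Proof.
move=> cg; have mg : measurable_fun setT (g : T -> borel X).
  by apply: (measurable_into_borel norm_dot sepX) => h; case: (cg h).
pose F : set (borel X -> R) := [set f | exists h a, f = fun x => dot h x + a].
apply: (@ge0_integral_fourier_law _ _ _ _ _ _ _ _ mg F) => //.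
- move=> _ [h [a ->]]; apply: measurable_funD => //.
  exact: measurable_dot.
- move=> a _ _ [h [b ->]] [k [c ->]]; exists (a *: h + k), (a * b + c).
  by apply/funext => x; rewrite dotDl dotZl; ring.
- by move=> c; exists 0, c; apply/funext => x; rewrite dot0l add0r.
- move=> G sG FG; apply: (borel_generated_by_dot norm_dot sepX sG) => h a.
  by apply: FG; exists h, a.
- move=> _ [h [a ->]]; rewrite (proj2 (cg h)).
  by rewrite (proj2 (centered_gaussian_cos_transform h)).
Qed.

End gaussian_law.

(** * Cameron-Martin spaces *)

Section cameron_martin.
Context {R : realType} {X : completeNormedModType R}.
Variable dot : {dot X for idfun}.
Hypothesis norm_dot : forall x : X, `|x| = Num.sqrt (dot x x).
Variables (Q S : X -> X) (e : nat -> X).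
Hypothesis S_sqrt : sqrt_op (whole dot) Q S.
Hypothesis e_basis : eigenbasis dot Q e.

Local Notation H := (cameron_martin dot S).

Let S_lin a h k : S (a *: h + k) = a *: S h + S k.
Proof. by case: S_sqrt => -[[_ + _] _ _] _; apply. Qed.

Let S_sym h k : dot (S h) k = dot h (S k).
Proof. by case: S_sqrt => -[_ + _] _; apply. Qed.

Let S_pos h : 0 <= dot (S h) h.
Proof. by case: S_sqrt => -[_ _ +] _; apply. Qed.

Let SS h : S (S h) = Q h.
Proof. by case: S_sqrt => _; apply. Qed.

Let S0 : S 0 = 0.
Proof.
by have := S_lin (- 1) 0 0; rewrite scaler0 addr0 scaleN1r addNr.
Qed.

Let SD h k : S (h + k) = S h + S k.
Proof. by have := S_lin 1 h k; rewrite !scale1r. Qed.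

Let SZ a h : S (a *: h) = a *: S h.
Proof. by have := S_lin a h 0; rewrite !addr0 S0 addr0. Qed.

Let SB h k : S (h - k) = S h - S k.
Proof. by rewrite SD -scaleN1r SZ scaleN1r. Qed.

(** [|S w|^2 = <w, Q w>]. Hence [Q] and its root have the same kernel, and the eigenbasis of [Q]
    serves for [ker_perp S]. *)
Lemma sqrt_op_ker w : Q w = 0 -> S w = 0.
Proof.
move=> Qw; apply: (dot_eq0 (dot := dot)).
by rewrite S_sym SS Qw dot0r.
Qed.

Let ker_perpQS z : ker_perp dot Q z <-> ker_perp dot S z.
Proof.
split=> Kz w.
  by move=> Sw; apply: Kz; rewrite -SS Sw S0.
by move=> /sqrt_op_ker; exact: Kz.
Qed.

Let ker_perpS h : ker_perp dot S (S h).
Proof. by move=> w Sw; rewrite S_sym Sw dot0r. Qed.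

Let ee i j : dot (e i) (e j) = if i == j then dot (e i) (e i) else 0.
Proof. by case: eqVneq => [->//|ij]; case: e_basis => + _ _ _ _; exact. Qed.

(** Valid alike for unit vectors and for the zero vectors that pad a finite basis, so that
    [dot_proj] treats both at once. *)
Let dot_eZ x k : dot x (e k) * dot (e k) (e k) = dot x (e k).
Proof.
case: e_basis => _ [+ _] _ _ _ => /(_ k)[->|->]; last by rewrite mulr1.
by rewrite !dot0r mulr0.
Qed.

Let dot_proj m x k : dot (Defs.proj dot e m x) (e k) =
  if (k < m)%N then dot x (e k) else 0.
Proof.
rewrite /Defs.proj dot_suml; under eq_bigr do rewrite dotZl ee.
case: ifPn => [km|]; last first.
  rewrite -leqNgt => mk; rewrite big1// => i _.
  by rewrite ifN ?mulr0// neq_ltn (leq_trans (ltn_ord i) mk).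
rewrite (bigD1 (Ordinal km))//= eqxx dot_eZ big1 ?addr0// => i ik.
by rewrite ifN ?mulr0//; apply: contra ik => /eqP ik; apply/eqP/val_inj.
Qed.

Let dot_projM m n x y : (n <= m)%N ->
  dot (Defs.proj dot e m x) (Defs.proj dot e n y) =
  \sum_(k < n) dot x (e k) * dot y (e k).
Proof.
move=> nm; rewrite {2}/Defs.proj dot_sumr; apply: eq_bigr => k _.
by rewrite dotZr dot_proj (leq_trans (ltn_ord k) nm) mulrC.
Qed.

Let dot_proj_self m x : dot (Defs.proj dot e m x) x = \sum_(k < m) dot x (e k) ^+ 2.
Proof.
by rewrite /Defs.proj dot_suml; apply: eq_bigr => k _; rewrite dotZl dotC expr2.
Qed.

Let bessel m x : \sum_(k < m) dot x (e k) ^+ 2 <= dot x x.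
Proof.
set s := \sum_(k < m) _.
have ss : dot (Defs.proj dot e m x) (Defs.proj dot e m x) = s.
  by rewrite dot_projM//; apply: eq_bigr => k _; rewrite expr2.
have := dot_ge0 dot (x - Defs.proj dot e m x).
rewrite dotBl !dotBr ss (dotC _ x) dot_proj_self -/s; lra.
Qed.

(** The squared distance of two projections is a difference of partial sums of [<x, e k>^2], a
    series that converges by Bessel's inequality. Here [x] is arbitrary, while [eigenbasis] gives
    the limit for [x] in [ker_perp Q]. *)
Lemma cvg_proj x : cvg (Defs.proj dot e m x @[m --> \oo]).
Proof.
pose s m := \sum_(k < m) dot x (e k) ^+ 2.
have dist m n : (n <= m)%N ->
    `|Defs.proj dot e m x - Defs.proj dot e n x| ^+ 2 = s m - s n.
  move=> nm; rewrite -(dot_norm norm_dot) dotBl !dotBr.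
  rewrite (dotC _ _ (Defs.proj dot e m x)) !dot_projM//.
  rewrite /s; under eq_bigr do rewrite -expr2.
  under [X in _ - X - _]eq_bigr do rewrite -expr2.
  under [X in _ - _ - (_ - X)]eq_bigr do rewrite -expr2.
  under [X in _ - _ - (X - _)]eq_bigr do rewrite -expr2.
  ring.
have cs : cvg (s m @[m --> \oo]).
  apply: nondecreasing_is_cvgn.
    apply/nondecreasing_seqP => m; rewrite /s big_ord_recr/= lerDl.
    exact: sqr_ge0.
  by exists (dot x x) => _ [m _ <-]; exact: bessel.
apply/cauchy_cvgP/cauchy_ballP => eps eps0.
have /cauchy_cvgP/cauchy_ballP/(_ _ (exprn_gt0 2 eps0)) := cs.
move=> [[A B]/= [[a _ aA] [b _ bB]] AB].
pose tl := [set Defs.proj dot e m x | m in [set m | (maxn a b <= m)%N]].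
exists (tl, tl).
  by split; exists (maxn a b) => // m mm; exists m.
move=> [_ _] /= [[m /= mm <-] [n /= nn <-]]; rewrite -ball_normE /=.
wlog : m n mm nn / (n <= m)%N.
  move=> hw; have [nm|/ltnW mn] := leqP n m; first exact: hw.
  by rewrite distrC; exact: hw.
move=> nm; rewrite -(@ltr_pXn2r _ 2)// ?nnegrE ?(ltW eps0)// dist//.
rewrite (le_lt_trans (ler_norm _))//.
have := AB (s m, s n); rewrite -ball_normE /=; apply; split.
  by apply: aA; rewrite /= (leq_trans (leq_maxl a b)).
by apply: bB; rewrite /= (leq_trans (leq_maxr a b)).
Qed.

(** Two candidates differ by a vector that lies in the kernel and is orthogonal to it. *)
Lemma pinv_unique z h : ker_perp dot S z -> S z = h -> Defs.pinv dot S h = z.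
Proof.
move=> Kz Sz; rewrite /Defs.pinv; case: xgetP => [y _ [Ky Sy]|/(_ z)[]//].
apply/eqP; rewrite -subr_eq0; apply/eqP/(dot_eq0 (dot := dot)).
have Syz : S (y - z) = 0 by rewrite SB Sy Sz subrr.
by rewrite dotBl Ky// Kz// subrr.
Qed.

(** The preimage is found by projecting any [x] with [S x = h] onto the closed span of the basis:
    the limit [z] is orthogonal to the kernel, and [z - x] is orthogonal to every [e k]. *)
Lemma pinvP h : range S h ->
  ker_perp dot S (Defs.pinv dot S h) /\ S (Defs.pinv dot S h) = h.
Proof.
move=> [x _ <-]; set z := lim (Defs.proj dot e m x @[m --> \oo]).
have cz : Defs.proj dot e m x @[m --> \oo] --> z by exact: cvg_proj.
have dotz w : dot w (Defs.proj dot e m x) @[m --> \oo] --> dot w z.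
  by apply: cvg_comp cz _; exact: dot_continuous.
have eK k : ker_perp dot Q (e k) by case: e_basis.
have Kz : ker_perp dot S z.
  move=> w Sw; rewrite dotC; apply: cvg_unique (dotz w) _ => //.
  have -> : (fun m => dot w (Defs.proj dot e m x)) = fun=> 0; last exact: cvg_cst.
  apply/funext => m; rewrite /Defs.proj dot_sumr big1// => k _.
  by rewrite dotZr (dotC _ w) (eK k) ?mulr0// -SS Sw S0.
have ez k : dot (e k) z = dot (e k) x.
  apply: cvg_unique (dotz (e k)) _ => //; apply: cvg_near_cst; near=> m.
  rewrite dotC dot_proj ifT ?(dotC _ x)//.
  by near: m; exact: nbhs_infty_gt.
have Sz : S z = S x.
  apply/eqP; rewrite -subr_eq0 -SB; apply/eqP/(dot_eq0 (dot := dot)).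
  (* [|v|^2 = <z - x, S v>] vanishes, because [S v] expands in the basis, to which [z - x] is
     orthogonal. *)
  set v := S (z - x); rewrite {1}/v S_sym.
  have cv : Defs.proj dot e m (S v) @[m --> \oo] --> S v.
    by case: e_basis => _ _ _ _; apply; apply/ker_perpQS; exact: ker_perpS.
  have dv : dot (z - x) (Defs.proj dot e m (S v)) @[m --> \oo] --> dot (z - x) (S v).
    by apply: cvg_comp cv _; exact: dot_continuous.
  apply: cvg_unique dv _ => //.
  have -> : (fun m => dot (z - x) (Defs.proj dot e m (S v))) = fun=> 0; last exact: cvg_cst.
  apply/funext => m; rewrite /Defs.proj dot_sumr big1// => k _.
  by rewrite dotZr (dotC _ (z - x)) dotBr ez subrr mulr0.
by rewrite (pinv_unique Kz Sz).
Unshelve. all: by end_near. Qed.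

(** The reproducing property of the Cameron-Martin space: [Q h = S (S h)] with [S h] orthogonal to
    the kernel, so [pinv] recovers [S h]. *)
Lemma cameron_martin_ipQ g h : range S g -> ip H g (Q h) = dot g h.
Proof.
move=> /pinvP[_ Sg] /=; rewrite (@pinv_unique (S h) (Q h))//.
by rewrite -S_sym Sg.
Qed.

Lemma range_Q h : range S (Q h).
Proof. by rewrite -SS; exists (S h). Qed.

(** A positive root acts on an eigenvector of [Q] for [a > 0] as [sqrt a]. The zero vectors of the
    sequence get the arbitrary value [b = 1]. *)
Let S_e k : exists2 b, S (e k) = b *: e k & e k != 0 -> 0 < b.
Proof.
have [_ [e01 _] eig eK _] := e_basis.
have [->|ek0] := eqVneq (e k) 0; first by exists 1; rewrite ?S0 ?scaler0// eqxx.
have [a Qa] := eig k.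
have ek1 : dot (e k) (e k) = 1 by case: (e01 k) => // ek; rewrite ek eqxx in ek0.
have a_ge0 : 0 <= a.
  have : 0 <= dot (Q (e k)) (e k) by rewrite -SS S_sym dot_ge0.
  by rewrite Qa dotZl ek1 mulr1.
have a0 : 0 < a.
  rewrite lt_neqAle a_ge0 andbT; apply/eqP => a0.
  have := eK k (e k); rewrite Qa -a0 scale0r => /(_ erefl) /eqP.
  by rewrite ek1 oner_eq0.
have b0 : 0 < Num.sqrt a by rewrite sqrtr_gt0.
exists (Num.sqrt a) => //.
apply/eqP; rewrite -subr_eq0; apply/eqP; set b := Num.sqrt a in b0 *.
(* [w] would be an eigenvector of [S] for the negative eigenvalue [- b]. *)
set w := S (e k) - b *: e k.
have Sw : S w = - b *: w.
  rewrite /w SB SZ SS Qa scalerBr scalerA scaleNr mulNr scaleNr opprK.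
  by rewrite -expr2 sqr_sqrtr// addrC.
have := S_pos w; rewrite Sw dotZl mulNr oppr_ge0 pmulr_rle0// => w0.
by apply: (dot_eq0 (dot := dot)); apply/eqP; rewrite eq_le w0 dot_ge0.
Qed.

Lemma range_sum (I : Type) (r : seq I) (P : pred I) (f : I -> X) :
  (forall i, P i -> range S (f i)) -> range S (\sum_(i <- r | P i) f i).
Proof.
move=> Sf; apply: (big_ind (range S)) => //.
  by exists 0.
by move=> _ _ [x _ <-] [y _ <-]; exists (x + y).
Qed.

Lemma rangeZ a x : range S x -> range S (a *: x).
Proof. by move=> [y _ <-]; exists (a *: y). Qed.

Lemma range_e k : range S (e k).
Proof.
have [b Sb b0] := S_e k.
have [->|/b0 {}b0] := eqVneq (e k) 0; first by exists 0.
by exists (b^-1 *: e k) => //; rewrite SZ Sb scalerA mulVf ?gt_eqF// scale1r.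
Qed.

(** For [V] linear, the Riesz vector of the functional [x |-> <h, V (proj e m x)>]. *)
Definition weight (V : X -> X) (h : X) (m : nat) : X :=
  \sum_(k < m) dot h (V (e k)) *: e k.

Section represented_functional.
Variables (V : X -> X) (h g : X).
Hypothesis V_lin : forall a x y, range S x -> range S y ->
  V (a *: x + y) = a *: V x + V y.
Hypothesis range_g : range S g.
Hypothesis V_repr : forall k, range S k -> dot h (V k) = ip H g k.

Lemma linear_proj m x : V (Defs.proj dot e m x) = \sum_(k < m) dot x (e k) *: V (e k).
Proof.
have V0 : V 0 = 0.
  have r0 : range S 0 by exists 0.
  by have := V_lin (- 1) r0 r0; rewrite scaler0 addr0 scaleN1r addNr.
have key (r : seq 'I_m) : V (\sum_(k <- r) dot x (e k) *: e k) =
    \sum_(k <- r) dot x (e k) *: V (e k).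
  elim: r => [|k r IH]; first by rewrite !big_nil.
  rewrite !big_cons V_lin ?IH//; first exact: range_e.
  by apply: range_sum => i _; exact/rangeZ/range_e.
exact: key.
Qed.

Lemma dot_linear_proj m x : dot h (V (Defs.proj dot e m x)) = dot (weight V h m) x.
Proof.
rewrite linear_proj dot_sumr /weight dot_suml; apply: eq_bigr => k _.
by rewrite dotZr dotZl mulrC (dotC _ x).
Qed.

(** With [z = pinv S g] and [S (e k) = b *: e k], the coefficient [<h, V (e k)>] of a nonzero [e k]
    is [<z, e k> / b], so [S] maps the weight to the projection of [z]. The variance is thus
    [|proj e m z|^2], with limit [|z|^2]. *)
Lemma cvg_weight : dot (Q (weight V h m)) (weight V h m) @[m --> \oo] --> ip H g g.
Proof.
have [Kz Sz] := pinvP range_g; set z := Defs.pinv dot S g in Kz Sz.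
have S_sum (I : Type) (r : seq I) (f : I -> X) :
    S (\sum_(i <- r) f i) = \sum_(i <- r) S (f i).
  by elim: r => [|i r IH]; rewrite ?big_nil// !big_cons SD IH.
have Sw m : S (weight V h m) = Defs.proj dot e m z.
  rewrite /weight /Defs.proj S_sum.
  apply: eq_bigr => k _; rewrite SZ.
  have [b Sb b0] := S_e k; rewrite Sb.
  have [->|ek0] := eqVneq (e k) 0; first by rewrite !scaler0.
  have {}b0 := b0 ek0.
  rewrite scalerA V_repr; last exact: range_e.
  congr (_ *: _); rewrite /= -/z.
  have eKS : ker_perp dot S (e k).
    by apply/ker_perpQS; case: e_basis.
  rewrite (@pinv_unique (b^-1 *: e k)).
  - by rewrite dotZr mulrC mulrA mulfV ?mul1r// gt_eqF.
  - by move=> w /eKS; rewrite dotZl => ->; rewrite mulr0.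
  - by rewrite SZ Sb scalerA mulVf ?gt_eqF// scale1r.
have -> : (fun m => dot (Q (weight V h m)) (weight V h m)) =
    (fun m => `|Defs.proj dot e m z| ^+ 2).
  by apply/funext => m; rewrite -SS S_sym Sw (dot_norm norm_dot).
rewrite /= -/z (dot_norm norm_dot) expr2; under eq_fun do rewrite expr2.
have cz : Defs.proj dot e m z @[m --> \oo] --> z.
  by case: e_basis => _ _ _ _; apply; exact/ker_perpQS.
by apply: cvgM; apply: cvg_norm.
Qed.

End represented_functional.

End cameron_martin.

(** * Completion measurability *)

Section null_modification.
Context {R : realType} d {T : measurableType d}.
Variable m : {measure set T -> \bar R}.
Variable N : set T.
Hypotheses (mN : measurable N) (N0 : m N = 0%E).

Import HBNNSimple.

(* [f] and [g] need not be measurable: the integral is a supremum over simple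
   functions, each of which may be set to [0] on [N]. *)
Lemma eq_integral_off_null (f g : T -> \bar R) :
  (forall x, ~ N x -> f x = g x) -> (\int[m]_x f x = \int[m]_x g x)%E.
Proof.
have key (u v : T -> \bar R) : (forall x, 0 <= v x)%E ->
    (forall x, ~ N x -> u x = v x) ->
    (ereal_sup [set sintegral m h | h in [set h : {nnsfun T >-> R} |
       forall x, ((h x)%:E <= u x)%E]] <=
     ereal_sup [set sintegral m h | h in [set h : {nnsfun T >-> R} |
       forall x, ((h x)%:E <= v x)%E]])%E.
  move=> v0 uv; apply: ge_ereal_sup => _ [h /= hu <-].
  apply: ereal_sup_ubound.
  exists (proj_nnsfun h (measurableC mN)) => /=.
    move=> x; rewrite mindicE; have [|] := boolP (x \in ~` N).
      by rewrite inE => Nx; rewrite mulr1 -uv.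
    by rewrite mulr0.
  rewrite -!integralT_nnsfun; apply: ge0_ae_eq_integral => //.
  - exact/measurable_EFinP.
  - exact/measurable_EFinP.
  - by move=> x _; rewrite lee_fin.
  - by move=> x _; rewrite lee_fin.
  - exists N; split => // x /= /not_implyP[_]; apply: contra_notP => Nx.
    by rewrite mindicE mem_set// mulr1.
move=> fg; rewrite /integral !patch_setT.
have fgp x : ~ N x -> (f^\+ x = g^\+ x)%E by move=> Nx; rewrite !funeposE fg.
have fgn x : ~ N x -> (f^\- x = g^\- x)%E by move=> Nx; rewrite !funenegE fg.
congr (_ - _)%E; apply/eqP; rewrite eq_le; apply/andP; split; apply: key => //.
- by move=> x Nx; rewrite fgp.
- by move=> x Nx; rewrite fgn.
Qed.

End null_modification.

(** * Borel modifications of maps measurable for the completion *)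

Section completion_modification.
Context {R : realType} {X : completeNormedModType R}.
Hypothesis sepX : separable X.
Variable mu : probability (borel X) R.

(** The sets that agree with a Borel set outside a Borel null set form a sigma-algebra that contains
    the generators of the completion. *)
Lemma completion_measurableP (E : set X) :
  (completed_algebra_gen (mu : set (borel X) -> \bar R)).-sigma.-measurable E ->
  exists (B : set (borel X)) (N : set (borel X)),
    [/\ measurable B, measurable N, mu N = 0%E
    & forall x, ~ N x -> E x <-> B x].
Proof.
pose G : set_system X := [set E | exists (B : set (borel X)) (N : set (borel X)),
  [/\ measurable B, measurable N, mu N = 0%E & forall x, ~ N x -> E x <-> B x]].
suff : <<s completed_algebra_gen (mu : set (borel X) -> \bar R) >> `<=` G by exact.
apply: smallest_sub; last first.
  move=> _ [/= A mA [N0 [N [mN muN N0N]]] <-]; exists A, N; split => // x Nx.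
  by split; [case=> // /N0N|left].
split.
- exists set0, set0; split => //; exact: measurable0.
- move=> A [B [N [mB mN muN AB]]]; rewrite setTD; exists (~` B), N; split => //.
    exact: measurableC.
  by move=> x Nx; rewrite /setC/= (AB x Nx).
- move=> A GA; pose P n (BN : set (borel X) * set (borel X)) :=
    [/\ measurable BN.1, measurable BN.2, mu BN.2 = 0%E
      & forall x, ~ BN.2 x -> A n x <-> BN.1 x].
  have /choice[F FP] : forall n, exists BN, P n BN.
    by move=> n; have [B [N ?]] := GA n; exists (B, N).
  exists (\bigcup_n (F n).1), (\bigcup_n (F n).2); split.
  + by apply: bigcupT_measurable => n; case: (FP n).
  + by apply: bigcupT_measurable => n; case: (FP n).
  + apply: measure_negligible.
      by apply: bigcupT_measurable => n; case: (FP n).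
    apply: negligible_bigcup => n; have [_ mFn Fn0 _] := FP n.
    by exists (F n).2; split.
  + move=> x nN; have FPx n : A n x <-> (F n).1 x.
      by have [_ _ _] := FP n; apply=> Fx; apply: nN; exists n.
    by split=> -[n _ /FPx]; exists n.
Qed.

(** Countably many balls describe every open set, so the null sets attached to the preimages of
    these balls have a null union [N], and it suffices to redefine [L] on [N]. *)
Lemma completion_measurable_fun (L : X -> X) :
  measurable_fun setT
    (L : g_sigma_algebraType
           (completed_algebra_gen (mu : set (borel X) -> \bar R)) -> borel X) ->
  exists (L' : X -> X) (N : set (borel X)),
    [/\ measurable_fun setT (L' : borel X -> borel X), measurable N, mu N = 0%E
      & forall x, ~ N x -> L x = L' x].
Proof.
move=> mL; have [C [Cball Copen]] := open_bigcup_balls sepX.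
have mC k : measurable (C k : set (borel X)).
  have [->|[a [r [r0 ->]]]] := Cball k; first exact: measurable0.
  have mn : measurable_fun setT (fun x : borel X => `|(x : X) - a|).
    by apply: continuous_measurable_borel => x; apply: cvg_norm; apply: cvgB;
      [exact: cvg_id|exact: cvg_cst].
  have := mn measurableT `]-oo, r]%classic (measurable_itv _).
  by rewrite setTI; congr measurable; apply/seteqP; split => t /=;
    rewrite in_itv.
pose P k (BN : set (borel X) * set (borel X)) :=
  [/\ measurable BN.1, measurable BN.2, mu BN.2 = 0%E
    & forall x, ~ BN.2 x -> C k (L x) <-> BN.1 x].
have /choice[F FP] : forall k, exists BN, P k BN.
  move=> k; have := mL measurableT _ (mC k); rewrite setTI.
  by move=> /completion_measurableP[B [N ?]]; exists (B, N).
pose N := \bigcup_n (F n).2.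
have mN : measurable N by apply: bigcupT_measurable => n; case: (FP n).
exists (fun x => if x \in N then 0 else L x), N; split => //.
- apply: (@measurability _ _ (borel X) (borel X) setT _ (@open X)) => // _ [U oU <-].
  rewrite setTI.
  rewrite (Copen U oU) preimage_bigcup bigcup_mkcond.
  apply: bigcupT_measurable => k; case: ifPn => // _.
  have [mB mN' muN' CB] := FP k.
  (* The modified map is [0] on [N], so the preimage of [C k] contains all of [N] or none of it. *)
  rewrite [X in measurable X](_ : _ = ((F k).1 `\` N) `|`
      (if 0 \in C k then N else set0)).
    apply: measurableU; first exact: measurableD.
    by case: ifPn.
  apply/seteqP; split=> x /=.
    have [|] := boolP (x \in N).
      by rewrite inE => Nx C0; right; rewrite ifT// inE.
    rewrite notin_setE => Nx Cx; left; split => //.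
    by apply/CB => // Fx; apply: Nx; exists k.
  move=> [[Bx Nx]|].
    rewrite ifN ?notin_setE//; apply/CB => // Fx; apply: Nx; exists k => //.
  by case: ifPn => // + Nx; rewrite inE => C0; rewrite ifT// inE.
- apply: measure_negligible => //; apply: negligible_bigcup => n.
  by have [_ mFn Fn0 _] := FP n; exists (F n).2; split.
- by move=> x Nx; rewrite ifN// notin_setE.
Qed.

End completion_modification.

(** * The law of the Mehler map *)

Section version_law.
Context {R : realType} {X : completeNormedModType R}.
Variable dot : {dot X for idfun}.
Hypothesis norm_dot : forall x : X, `|x| = Num.sqrt (dot x x).
Hypothesis sepX : separable X.

(** [<h, L'>] is the mean square limit of the functionals [<weight dot e V h m, .>], which are
    Gaussian with variances tending to the squared Cameron-Martin norm of [g]. *)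
Lemma version_cos_transform (mu : probability (borel X) R) (Q S : X -> X)
    (e : nat -> X) (V L L' : X -> X) (N : set (borel X)) (h g : X) :
  centered_gaussian dot mu Q -> sqrt_op (whole dot) Q S ->
  eigenbasis dot Q e ->
  (forall a x y, range S x -> range S y -> V (a *: x + y) = a *: V x + V y) ->
  range S g ->
  (forall k, range S k -> dot h (V k) = ip (cameron_martin dot S) g k) ->
  (\int[mu]_x (`|V (Defs.proj dot e m x) - L x| ^+ 2)%:E)%E @[m --> \oo] --> 0%E ->
  measurable_fun setT (L' : borel X -> borel X) ->
  measurable N -> mu N = 0%E -> (forall x, ~ N x -> L x = L' x) ->
  cos_transform mu (fun x => dot h (L' x))
    (expR (- (ip (cameron_martin dot S) g g / 2))).
Proof.
move=> mu_gauss S_sqrt e_basis V_lin range_g V_repr VL mL' mN N0 LL'.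
have mV m :
    measurable_fun setT ((fun x => V (Defs.proj dot e m x)) : borel X -> borel X).
  apply: (measurable_into_borel norm_dot sepX) => k.
  have -> : (fun x => dot k (V (Defs.proj dot e m x))) =
      (fun x => dot (weight dot e V k m) x).
    by apply/funext => x; rewrite (dot_linear_proj S_sqrt e_basis k V_lin).
  exact: measurable_dot.
have mhV m :
    measurable_fun setT ((fun x => dot h (V (Defs.proj dot e m x))) : borel X -> R).
  exact: measurableT_comp (measurable_dot norm_dot h) (mV m).
have mhL : measurable_fun setT ((fun x => dot h (L' x)) : borel X -> R).
  exact: measurableT_comp (measurable_dot norm_dot h) mL'.
apply: (@cos_transform_cvg R _ (borel X) mu
    (fun m (x : borel X) => dot h (V (Defs.proj dot e m x)))
    (fun x : borel X => dot h (L' x))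
    (fun m => expR (- (dot (Q (weight dot e V h m)) (weight dot e V h m) / 2)))) => //.
- move=> m.
  have := centered_gaussian_cos_transform norm_dot mu_gauss (weight dot e V h m).
  congr cos_transform; apply/funext => x.
  by rewrite (dot_linear_proj S_sqrt e_basis h V_lin).
- have cw : - (dot (Q (weight dot e V h m)) (weight dot e V h m) / 2) @[m --> \oo] -->
      - (ip (cameron_martin dot S) g g / 2).
    apply: cvgN; apply: cvgMl.
    exact: (cvg_weight norm_dot S_sqrt e_basis range_g V_repr).
  by apply: cvg_comp cw _; exact: continuous_expR.
have mVL m : measurable_fun setT
    ((fun x => `|V (Defs.proj dot e m x) - L' x| ^+ 2) : borel X -> R).
  apply: measurable_funX; apply: (measurableT_comp (@measurable_norm R X)).
  apply: (measurable_into_borel norm_dot sepX) => k.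
  under eq_fun do rewrite dotBr.
  apply: measurable_funB.
    exact: measurableT_comp (measurable_dot norm_dot k) (mV m).
  exact: measurableT_comp (measurable_dot norm_dot k) mL'.
(* By Cauchy-Schwarz this integrand dominates the square of [<h, V (proj e m x) - L' x>]. *)
have VL2 : (\int[mu]_x ((`|h| ^+ 2)%:E * (`|V (Defs.proj dot e m x) - L' x| ^+ 2)%:E))%E
    @[m --> \oo] --> 0%E.
  have -> :
      (fun m => \int[mu]_x ((`|h| ^+ 2)%:E * (`|V (Defs.proj dot e m x) - L' x| ^+ 2)%:E))%E =
      (fun m => (`|h| ^+ 2)%:E * \int[mu]_x (`|V (Defs.proj dot e m x) - L' x| ^+ 2)%:E)%E.
    apply/funext => m; rewrite ge0_integralZl_EFin//.
    exact/measurable_EFinP.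
  rewrite -(mule0 (`|h| ^+ 2)%:E); apply: cvgeZl => //.
  suff -> : (fun m => \int[mu]_x (`|V (Defs.proj dot e m x) - L' x| ^+ 2)%:E)%E =
      (fun m => \int[mu]_x (`|V (Defs.proj dot e m x) - L x| ^+ 2)%:E)%E by [].
  apply/funext => m; apply: (eq_integral_off_null mN N0) => x Nx.
  by rewrite LL'.
apply: squeeze_cvge VL2; last exact: cvg_cst.
apply: nearW => m; apply/andP; split.
  by apply: integral_ge0 => x _; rewrite lee_fin sqr_ge0.
apply: ge0_le_integral => //.
- by move=> x _; rewrite lee_fin sqr_ge0.
- by apply/measurable_EFinP; apply: measurable_funX; exact: measurable_funB.
- by apply/measurable_EFinP; apply: measurable_funM => //; exact: measurable_cst.
move=> x _; rewrite -EFinM lee_fin -dotBr -exprMn -real_normK ?num_real//.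
rewrite ler_pXn2r// ?nnegrE ?mulr_ge0//.
exact: cauchy_schwarz.
Qed.

(** The reproducing property gives [<h, Tstar k> = <T (Qmu h), k>] in [H_nu] and
    [<h, D k> = <D (Qmu h), k>] in [H_mu], which are the representations that
    [version_cos_transform] asks for. *)
Lemma integral_Mehler (mu nu : probability (borel X) R) (Qmu Qnu Smu Snu : X -> X)
    (emu enu : nat -> X) (T Tstar D A B A' B' : X -> X) (NA NB : set (borel X)) :
  centered_gaussian dot mu Qmu -> centered_gaussian dot nu Qnu ->
  sqrt_op (whole dot) Qmu Smu -> sqrt_op (whole dot) Qnu Snu ->
  eigenbasis dot Qmu emu -> eigenbasis dot Qnu enu ->
  bounded_op (cameron_martin dot Smu) (cameron_martin dot Snu) T ->
  adjoint_op (cameron_martin dot Smu) (cameron_martin dot Snu) T Tstar ->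
  sqrt_op (cameron_martin dot Smu) (fun h => h - Tstar (T h)) D ->
  linear_version dot nu enu Tstar A -> linear_version dot mu emu D B ->
  measurable_fun setT (A' : borel X -> borel X) -> measurable NA ->
  nu NA = 0%E -> (forall x, ~ NA x -> A x = A' x) ->
  measurable_fun setT (B' : borel X -> borel X) -> measurable NB ->
  mu NB = 0%E -> (forall x, ~ NB x -> B x = B' x) ->
  forall f : borel X -> \bar R,
    measurable_fun setT f -> (forall x, (0 <= f x)%E) ->
    (\int[(nu \x mu)%E]_z f (A' z.1 + B' z.2)%R = \int[mu]_x f x)%E.
Proof.
move=> mu_g nu_g Smu_s Snu_s emu_b enu_b T_b [Ts_b T_adj] [[D_b D_sym D_pos] DD].
move=> [_ _ vA] [_ _ vB] mA' mNA NA0 AA' mB' mNB NB0 BB'.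
set Hmu := cameron_martin dot Smu in T_b Ts_b T_adj D_b D_sym D_pos DD.
set Hnu := cameron_martin dot Snu in T_b Ts_b T_adj.
have ipC (S : X -> X) (a b : X) :
    ip (cameron_martin dot S) a b = ip (cameron_martin dot S) b a.
  by rewrite /= dotC.
have [T_car _ _] := T_b; have [Ts_car Ts_lin _] := Ts_b; have [D_car D_lin _] := D_b.
have ipQ := cameron_martin_ipQ norm_dot Smu_s emu_b.
apply: (gaussian_law norm_dot sepX mu_g) => h.
have rQ : range Smu (Qmu h) := range_Q Smu_s h.
have rT : range Snu (T (Qmu h)) := T_car _ rQ.
have rD : range Smu (D (Qmu h)) := D_car _ rQ.
have cA : cos_transform nu (fun x => dot h (A' x))
    (expR (- (ip Hnu (T (Qmu h)) (T (Qmu h)) / 2))).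
  apply: (version_cos_transform (L := A) nu_g Snu_s enu_b Ts_lin rT _
    vA mA' mNA NA0 AA').
  by move=> k rk; rewrite T_adj// ipC ipQ ?(dotC _ h)//; exact: Ts_car.
have cB : cos_transform mu (fun x => dot h (B' x))
    (expR (- (ip Hmu (D (Qmu h)) (D (Qmu h)) / 2))).
  apply: (version_cos_transform (L := B) mu_g Smu_s emu_b D_lin rD _
    vB mB' mNB NB0 BB').
  by move=> k rk; rewrite D_sym// ipC ipQ ?(dotC _ h)//; exact: D_car.
have := cos_transform_prod cA cB.
have -> : expR (- (ip Hnu (T (Qmu h)) (T (Qmu h)) / 2)) *
    expR (- (ip Hmu (D (Qmu h)) (D (Qmu h)) / 2)) = expR (- (dot (Qmu h) h / 2)).
  (* The two squared norms are [<Tstar (T (Qmu h)), h>] and [<Qmu h - Tstar (T (Qmu h)), h>]. *)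
  rewrite -expRD T_adj// ipC ipQ; last exact: Ts_car.
  rewrite -D_sym// DD// ipQ; last by rewrite -DD//; exact: D_car.
  by rewrite dotBl; congr expR; field.
by congr cos_transform; apply/funext => z; rewrite dotDr.
Qed.

End version_law.

(** * The operator on Lebesgue spaces *)

Section transfer_operator.
Context {R : realType}.
Local Open Scope ereal_scope.

(** Jensen's inequality for the power function, obtained from Hoelder's inequality against the
    constant [1]. *)
Lemma jensen_powR d (T : measurableType d) (P : probability T R) (u : T -> R)
    (p : R) : (1 <= p)%R -> measurable_fun setT u ->
  ((`|\int[P]_x u x| `^ p)%R)%:E <= \int[P]_x ((`|u x| `^ p)%R)%:E.
Proof.
move=> p1 mu; have p0 : (0 < p)%R by exact: lt_le_trans p1.
have abs_le : (`|\int[P]_x u x|%R)%:E <= \int[P]_x (`|u x|%R)%:E.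
  have h := le_abse_integral P measurableT ((measurable_EFinP _ _).2 mu).
  apply: le_trans h; rewrite /Rintegral.
  (* An infinite integral of [u] has the real value [0], which keeps the bound true. *)
  by case: (\int[P]_x (u x)%:E) => [r| |] //=; rewrite ?normr0 leey.
have Lp : \int[P]_x (`|u x|%R)%:E <= (\int[P]_x ((`|u x| `^ p)%R)%:E) `^ p^-1.
  (* For [p = 1] the conjugate exponent [(1 - 1 / p)^-1] would be infinite. *)
  have [p_eq1|p_neq1] := eqVneq p 1%R.
    rewrite p_eq1 invr1 poweRe1; last first.
      by apply: integral_ge0 => x _; rewrite lee_fin powR_ge0.
    by under [leRHS]eq_integral do rewrite powRr1//.
  have p_gt1 : (1 < p)%R by rewrite lt_neqAle eq_sym p_neq1.
  have q0 : (0 < (1 - p^-1)^-1)%R by rewrite invr_gt0 subr_gt0 invf_lt1.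
  have pq : (p^-1 + (1 - p^-1)^-1^-1 = 1)%R by rewrite invrK subrKC.
  have m1 : measurable_fun [set: T] (@cst _ R 1%R) by exact: measurable_cst.
  have := hoelder P mu m1 p0 q0 pq.
  rewrite Lnorm_cst1 [X in X `^ _](_ : _ = 1); last exact: probability_setT.
  rewrite poweR1r mule1 Lnorm1.
  by rewrite unlock /=; under eq_integral do rewrite mulr1.
have ge0_itv (x : \bar R) : 0 <= x -> x \in `[0, +oo%E]%R.
  by move=> x0; rewrite in_itv/= x0 leey.
rewrite -poweR_EFin.
rewrite (@le_trans _ _ ((\int[P]_x (`|u x|%R)%:E) `^ p))//.
  apply: gt0_ler_poweR => //; first exact: ltW.
    by apply: ge0_itv; rewrite lee_fin.
  by apply: ge0_itv; apply: integral_ge0 => x _; rewrite lee_fin.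
have -> : \int[P]_x ((`|u x| `^ p)%R)%:E =
    ((\int[P]_x ((`|u x| `^ p)%R)%:E) `^ p^-1) `^ p.
  rewrite -poweRrM mulVf ?gt_eqF// poweRe1//.
  by apply: integral_ge0 => x _; rewrite lee_fin powR_ge0.
apply: gt0_ler_poweR => //; first exact: ltW.
  by apply: ge0_itv; apply: integral_ge0 => x _; rewrite lee_fin.
exact/ge0_itv/poweR_ge0.
Qed.

Context d1 d2 d3 {T1 : measurableType d1} {T2 : measurableType d2}
  {T3 : measurableType d3}.
Variables (P1 : probability T1 R) (P2 : probability T2 R) (m : probability T3 R).
Variable K : T1 * T2 -> T3.
Hypothesis mK : measurable_fun setT K.
Hypothesis law_K : forall f : T3 -> \bar R, measurable_fun setT f ->
  (forall x, 0 <= f x) -> \int[P1 \x P2]_z f (K z) = \int[m]_x f x.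
Variables (p : R) (p1 : 1 <= p%:E).

(** A value is assigned at every [x], by convention where the slice [y |-> f (K (x, y))] is not
    integrable; such [x] are negligible when [f] is in [L^p]. *)
Definition transfer (f : T3 -> R) (x : T1) : R := (\int[P2]_y f (K (x, y)))%R.

Let p0 : (0 < p)%R. Proof. by move: p1; rewrite lee_fin; exact: lt_le_trans. Qed.

Let law_K2 (f : T3 -> \bar R) : measurable_fun setT f -> (forall x, 0 <= f x) ->
  \int[P1]_x \int[P2]_y f (K (x, y)) = \int[m]_x f x.
Proof.
move=> mf f0; rewrite -law_K//.
rewrite (@fubini_tonelli1 _ _ _ _ _ P1 P2 (f \o K))//.
  exact: (measurableT_comp mf mK).
by move=> z; exact: f0.
Qed.

Lemma measurable_transfer f : measurable_fun setT f ->
  measurable_fun setT (transfer f).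
Proof.
move=> mf; have mfK : measurable_fun setT (EFin \o (f \o K)).
  by apply/measurable_EFinP; exact: measurableT_comp.
(* [f] is only measurable here, so Tonelli's theorem is applied to its positive and negative parts
   separately. *)
have E x : \int[P2]_y (f (K (x, y)))%:E =
    fubini_F P2 (EFin \o (f \o K))^\+ x - fubini_F P2 (EFin \o (f \o K))^\- x.
  rewrite integralE /fubini_F; congr (_ - _); apply: eq_integral => y _.
    by rewrite !funeposE.
  by rewrite !funenegE.
apply: (@measurableT_comp _ _ _ _ _ _ (@fine R)) => //.
under eq_fun do rewrite E.
apply: emeasurable_funB.
  by apply: measurable_fun_fubini_tonelli_F => //; exact: measurable_funepos.
by apply: measurable_fun_fubini_tonelli_F => //; exact: measurable_funeneg.
Qed.

Let measurable_powR_norm d (T : measurableType d) (f : T -> R) :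
  measurable_fun setT f -> measurable_fun setT (fun x => ((`|f x| `^ p)%R)%:E).
Proof.
move=> mf; apply/measurable_EFinP.
by apply: (measurableT_comp (measurable_powR _)); exact: measurableT_comp.
Qed.

Lemma Lnorm_transfer f : measurable_fun setT f ->
  'N[P1]_p%:E[EFin \o transfer f] <= 'N[m]_p%:E[EFin \o f].
Proof.
move=> mf; rewrite unlock /=.
have ge0 d (T : measurableType d) (Q : {measure set T -> \bar R}) (g : T -> R) :
    0 <= \int[Q]_x ((`|g x| `^ p)%R)%:E.
  by apply: integral_ge0 => x _; rewrite lee_fin powR_ge0.
apply: gt0_ler_poweR; rewrite ?invr_ge0 ?(ltW p0)// ?in_itv/= ?leey ?ge0//.
have mfp : measurable_fun setT (fun x => ((`|f x| `^ p)%R)%:E).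
  exact: measurable_powR_norm.
have fp0 x : 0 <= ((`|f x| `^ p)%R)%:E by rewrite lee_fin powR_ge0.
rewrite -(law_K2 mfp fp0).
apply: ge0_le_integral => //.
- by apply: measurable_powR_norm; exact: measurable_transfer.
- apply: (@measurable_fun_fubini_tonelli_F _ _ _ _ _ P2 (fun z => ((`|f (K z)| `^ p)%R)%:E)).
  + exact: (measurableT_comp mfp mK).
  + by move=> z.
- move=> x _; apply: jensen_powR; first by rewrite -lee_fin.
  exact: (measurableT_comp mf (measurableT_comp mK (pair1_measurable x))).
Qed.

Lemma transfer_Lfun (f : LfunType m p1) : transfer f \in Lfun P1 p%:E.
Proof.
rewrite inE; apply/andP; split; rewrite inE/=; first exact: measurable_transfer.
by rewrite /finite_norm (le_lt_trans (Lnorm_transfer _))//; exact: Lfunction_finite.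
Qed.

Definition transferL (f : LfunType m p1) : LfunType P1 p1 :=
  Lfun_Sub p1 (transfer_Lfun f).

(** [L^p] is contained in [L^1] on a probability space, [K] carries the product measure to [m], and
    Fubini's theorem gives integrable slices. The additivity of the slice integrals rests on
    this. *)
Let ae_integrable_transfer (f : LfunType m p1) :
  {ae P1, forall x, P2.-integrable setT (fun y => (f (K (x, y)))%:E)}.
Proof.
have mfK : measurable_fun setT (EFin \o (f \o K)).
  by apply/measurable_EFinP; exact: measurableT_comp.
apply: (@ae_integrable1 _ _ _ _ _ P1 P2 (EFin \o (f \o K))).
apply/integrableP; split => //.
rewrite (law_K (f := fun x => (`|f x|%R)%:E)); last 2 first.
- by apply/measurable_EFinP; exact: measurableT_comp.
- by move=> x; rewrite lee_fin.
have /Lfun1_integrable/integrableP[_] : (f : T3 -> R) \in Lfun m 1 => //.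
apply: (Lfun_subset _ p1) (LfunP f) => //.
exact: fin_num_measure.
Qed.

Let transferL_lin (a : R) (f g : LfunType m p1) :
  transferL (a *: f + g)%R = (a *: transferL f + transferL g)%R %[ae P1].
Proof.
apply: filterS2 (ae_integrable_transfer f) (ae_integrable_transfer g) => x fx gx _.
rewrite /transferL /= /transfer /=.
rewrite RintegralD//=; first by rewrite RintegralZl.
exact: (integrableZl measurableT a fx).
Qed.

(** Compatibility with a.e. equality follows from the norm bound: [f - g] has norm [0], hence so
    does its image, which is a.e. the difference of the images. *)
Lemma transferL_linear : Lp_linear transferL.
Proof.
split=> //; move=> f g fg.
pose u : LfunType m p1 := (- 1 *: g + f)%R.
have fg0 : 'N[m]_p%:E[EFin \o u] = 0.
  rewrite unlock /= (@ae_eq_integral _ _ _ m setT (fun=> 0))//.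
  - by rewrite integral0 poweR0r// invr_neq0// gt_eqF.
  - exact: (measurable_powR_norm (measurable_funP u)).
  - apply: filterS fg => x /(_ I) fgx _.
    have ux : u x = 0%R.
      by rewrite -[LHS]/(- 1 * g x + f x)%R fgx mulN1r addNr.
    by rewrite -[LHS]/((`|u x| `^ p)%:E) ux normr0 powR0// gt_eqF.
have Gfg0 : 'N[P1]_p%:E[EFin \o transferL u] = 0.
  by apply/eqP; rewrite eq_le Lnorm_ge0 andbT -fg0 Lnorm_transfer.
have h0 : EFin \o transferL u = \0 %[ae P1].
  apply: Lnorm_eq0_eq0 Gfg0; last by rewrite lte_fin.
  exact/measurable_EFinP/(measurable_funP (transferL u)).
apply: filterS2 h0 (transferL_lin (- 1) g f) => x /(_ I) [ux] /(_ I) h _; move: h.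
rewrite -[LHS]/(transferL u x) [LHS]ux.
rewrite -[RHS]/(- 1 * transferL g x + transferL f x)%R mulN1r addrC.
by move=> /esym/eqP; rewrite subr_eq0 => /eqP.
Qed.

Lemma transferL_opnorm : Lp_opnorm transferL = 1.
Proof.
apply/eqP; rewrite eq_le; apply/andP; split.
  by apply: ge_ereal_sup => _ [f /= f1 <-]; rewrite (le_trans (Lnorm_transfer _)).
have c1 : (cst 1%R : T3 -> R) \in Lfun m p%:E by exact: Lfun_cst.
apply: ereal_sup_ubound; exists (Lfun_Sub p1 c1) => /=.
  rewrite Lnorm_cst1 [X in X `^ _](_ : _ = 1); last exact: probability_setT.
  by rewrite poweR1r.
have -> : EFin \o transfer (cst 1%R) = cst 1.
  apply/funext => x /=; rewrite /transfer Rintegral_cst// mul1r.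
  rewrite fineK ?fin_num_measure//; exact: probability_setT.
rewrite Lnorm_cst1 [X in X `^ _](_ : _ = 1); last exact: probability_setT.
by rewrite poweR1r.
Qed.

End transfer_operator.

(** * Fernique's theorem *)

Section fernique_tail.
Context {R : realType} d {T : measurableType d} (m : probability T R) (N : T -> R).
Hypothesis mN : measurable_fun setT N.

Definition tail (t : R) : R := fine (m [set x | t < N x]).

Lemma measurable_tail t : measurable [set x | t < N x].
Proof.
have := mN measurableT (measurable_itv `]t, +oo[).
by rewrite setTI; congr measurable; apply/seteqP; split => x /=;
  rewrite in_itv/= andbT.
Qed.

Lemma tailE t : m [set x | t < N x] = (tail t)%:E.
Proof. by rewrite fineK// fin_num_measure//; exact: measurable_tail. Qed.

Lemma tail_ge0 t : 0 <= tail t.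
Proof. by rewrite fine_ge0. Qed.

Lemma cvg_tail : tail n%:R @[n --> \oo] --> 0.
Proof.
have := @nonincreasing_cvg_mu _ _ _ m (fun n => [set x | n%:R < N x]).
have -> : \bigcap_n [set x | n%:R < N x] = set0.
  apply/seteqP; split=> // x /= h.
  have [n _ /(_ n (leqnn n))/=] := nbhs_infty_ger (N x).
  by rewrite leNgt h.
rewrite measure0 => h; apply: fine_cvg; apply: h => //.
- by rewrite -ge0_fin_numE// fin_num_measure//; exact: measurable_tail.
- by move=> n; exact: measurable_tail.
- move=> a b ab; apply/subsetPset => x /=; apply: le_lt_trans.
  by rewrite ler_nat.
Qed.

(** In the application [N] is the norm and [kappa] is [1 - tail s], the mass of the closed ball of
    radius [s]. *)
Variables (s kappa : R).
Hypothesis s1 : 1 <= s.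
Hypothesis kappa0 : 0 < kappa.
Hypothesis tail_rec : forall t, tail (s + Num.sqrt 2 * t) * kappa <= tail t ^+ 2.
Hypothesis tail_s : tail s <= kappa * expR (- 1).

Let r : R := Num.sqrt 2.
Let r0 : 0 < r. Proof. by rewrite sqrtr_gt0. Qed.
Let rr : r ^+ 2 = 2. Proof. by rewrite sqr_sqrtr. Qed.
Let r43 : 4 <= 3 * r.
Proof.
rewrite -(@ler_pXn2r _ 2) ?nnegrE// ?mulr_ge0 ?ltW//.
by rewrite exprMn rr; lra.
Qed.

Let level n := iter n (fun t => s + r * t) s.

(** From one level to the next, [tail_rec] squares the bound on [tail / kappa], which starts at
    [exp (- 1)] by [tail_s]. *)
Let tail_level n : tail (level n) <= kappa * expR (- 2 ^+ n).
Proof.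
elim: n => [|n IH]; first by rewrite expr0.
rewrite -(ler_pM2r kappa0) (le_trans (tail_rec _))//.
rewrite (@le_trans _ _ ((kappa * expR (- 2 ^+ n)) ^+ 2))//.
  by rewrite ler_pXn2r// nnegrE ?tail_ge0// mulr_ge0 ?expR_ge0// ltW.
have -> : expR (- 2 ^+ n.+1) = expR (- 2 ^+ n) ^+ 2 :> R.
  by rewrite -expRM_natl exprS mulrN.
by rewrite le_eqVlt; apply/orP; left; apply/eqP; ring.
Qed.

(** The constants give equality at [n = 0] and reduce the inductive step to [4 <= 3 * r]. *)
Let level_le n : level n <= 4 * s * r ^+ n - 3 * s.
Proof.
elim: n => [|n IH]; first by rewrite expr0 /level/=; lra.
rewrite /level iterS -/(level n) exprS.
have h : r * level n <= r * (4 * s * r ^+ n - 3 * s) by rewrite ler_wpM2l// ltW.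
have h2 : 4 * s <= 3 * r * s by apply: ler_wpM2r r43; rewrite (le_trans _ s1).
nra.
Qed.

(** This serves to show that the levels are unbounded, so that every value of [N] lies below one of
    them. *)
Let level_ge n : n.+1%:R <= level n.
Proof.
elim: n => [|n IH]; first by rewrite /level/=.
rewrite /level iterS -/(level n) -natr1 addrC lerD//.
rewrite (le_trans IH)// ler_peMl//; first by rewrite (le_trans _ IH).
by have := r43; lra.
Qed.

(** With [x = r ^+ n] and [b = 4 c s r], the exponential is at most [exp (b x)] and the tail at most
    [kappa exp (- x^2)]. Completing the square bounds the product by
    [kappa exp (b^2 / 2) exp (- x^2 / 2)], and [exp (- x^2 / 2) <= 2 / x^2] is geometric because
    [x^2 = 2^n]. *)
Let term_le (c : R) n : 0 <= c ->
  expR (c * level n.+1) * tail (level n) <=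
  (4 * kappa * expR ((4 * c * s * r) ^+ 2 / 2)) / (2 ^ n.+1)%:R.
Proof.
move=> c0; set b := 4 * c * s * r.
set x := r ^+ n.
have x0 : 0 < x by rewrite exprn_gt0.
have xx : x ^+ 2 = 2 ^+ n by rewrite -exprM mulnC exprM rr.
have e1 : expR (c * level n.+1) <= expR (b * x).
  rewrite ler_expR (le_trans (ler_wpM2l c0 (level_le _)))//.
  rewrite exprS -/x /b; have cs : 0 <= c * s by rewrite mulr_ge0// (le_trans _ s1).
  have -> : 4 * c * s * r * x = c * (4 * s * (r * x)) by ring.
  by rewrite ler_wpM2l// gerBl mulr_ge0// (le_trans _ s1).
have e2 : tail (level n) <= kappa * expR (- x ^+ 2) by rewrite xx.
apply: (@le_trans _ _ (expR (b * x) * (kappa * expR (- x ^+ 2)))).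
  by rewrite ler_pM ?expR_ge0 ?tail_ge0.
have -> : expR (b * x) * (kappa * expR (- x ^+ 2)) =
    kappa * (expR (b * x - x ^+ 2 / 2) * expR (- (x ^+ 2 / 2))).
  by rewrite mulrCA -!expRD; congr (_ * expR _); field.
have -> : 4 * kappa * expR (b ^+ 2 / 2) / (2 ^ n.+1)%:R =
    kappa * (expR (b ^+ 2 / 2) * (4 * (2 ^ n.+1)%:R^-1)) by ring.
rewrite ler_wpM2l ?(ltW kappa0)// ler_pM ?expR_ge0//.
  rewrite ler_expR -subr_ge0.
  have -> : b ^+ 2 / 2 - (b * x - x ^+ 2 / 2) = (b - x) ^+ 2 / 2 by field.
  by rewrite divr_ge0 ?sqr_ge0.
have -> : (2 ^ n.+1)%:R = 2 * x ^+ 2 :> R by rewrite natrX exprS xx.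
rewrite expRN.
rewrite (@le_trans _ _ (x ^+ 2 / 2)^-1)//.
  rewrite lef_pV2 ?posrE ?expR_gt0 ?divr_gt0 ?exprn_gt0//.
  by rewrite (le_trans _ (expR_ge1Dx _))// lerDr.
rewrite le_eqVlt; apply/orP; left; apply/eqP; field.
by rewrite gt_eqF.
Qed.

(** The space is cut into the set [N <= s] and the shells [level n < N <= level n.+1]; the shell
    terms are dominated by a geometric series. *)
Lemma integral_expR_lty (c : R) : 0 <= c ->
  (\int[m]_x (expR (c * N x))%:E < +oo)%E.
Proof.
move=> c0.
pose u n x : \bar R := (expR (c * level n.+1) * \1_[set x | level n < N x] x)%:E.
have u0 n x : (0 <= u n x)%E by rewrite lee_fin mulr_ge0// expR_ge0.
have mu n : measurable_fun setT (u n).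
  apply/measurable_EFinP; apply: measurable_funM; first exact: measurable_cst.
  by apply: measurable_indic; exact: measurable_tail.
apply: (@le_lt_trans _ _ (\int[m]_x ((expR (c * s))%:E + \sum_(0 <= n <oo) u n x))%E).
  apply: ge0_le_integral => //.
  - apply/measurable_EFinP; apply: measurableT_comp => //.
    by apply: measurable_funM => //; exact: measurable_cst.
  - apply: emeasurable_funD; first exact: measurable_cst.
    by apply: ge0_emeasurable_sum.
  - move=> x _; have [Ns|sN] := leP (N x) s.
      rewrite -[leLHS]adde0 leeD//; last by apply: nneseries_ge0.
      by rewrite lee_fin ler_expR ler_wpM2l.
    have [k Nk] : exists k, N x <= level k.
      have [n _ /(_ n (leqnn n))/= Nn] := nbhs_infty_ger (N x).
      exists n; rewrite (le_trans Nn)// (le_trans _ (level_ge n))//.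
      by rewrite ler_nat.
    (* The least level above [N x] has a positive index, since [level 0] is [s < N x]. *)
    have [[|n] Nn minn] := ex_minnP (ex_intro (fun k => N x <= level k) k Nk).
      by move: sN; rewrite ltNge Nn.
    have nN : level n < N x by rewrite ltNge; apply/negP => /minn; rewrite ltnn.
    rewrite (@le_trans _ _ (u n x))//.
      by rewrite lee_fin indicE mem_set// mulr1 ler_expR ler_wpM2l.
    rewrite -[leLHS]add0e leeD// ?lee_fin ?expR_ge0//.
    rewrite (@nneseriesD1 _ (u ^~ x) n xpredT)// leeDl//.
    by apply: nneseries_ge0.
rewrite ge0_integralD//; last 2 first.
- by move=> x _; apply: nneseries_ge0.
- by apply: ge0_emeasurable_sum.
rewrite integral_cst//= [X in (_ * X + _)%E](_ : _ = 1%E); last exact: probability_setT.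
rewrite mule1 integral_nneseries// lte_add_pinfty ?ltry//.
set K := 4 * kappa * expR ((4 * c * s * r) ^+ 2 / 2).
have K0 : 0 <= K by rewrite !mulr_ge0 ?expR_ge0// ltW.
apply: le_lt_trans (ltry K); apply: le_trans (epsilon_trick0 xpredT K0).
apply: lee_nneseries => [n _ _|n _]; first exact: integral_ge0.
have -> : (\int[m]_x u n x)%E = (expR (c * level n.+1) * tail (level n))%:E.
  under eq_integral do rewrite /u EFinM.
  rewrite ge0_integralZl_EFin ?expR_ge0//.
    rewrite integral_indic//; last exact: measurable_tail.
    by rewrite setIT EFinM -tailE.
  by apply/measurable_EFinP; apply: measurable_indic; exact: measurable_tail.
by rewrite lee_fin; exact: term_le.
Qed.

End fernique_tail.

(** * Exponential moments of a Gaussian measure *)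

Section fernique.
Context {R : realType} {X : completeNormedModType R}.
Variable dot : {dot X for idfun}.
Hypothesis norm_dot : forall x : X, `|x| = Num.sqrt (dot x x).
Hypothesis sepX : separable X.
Variables (mu : probability (borel X) R) (Q : X -> X).
Hypothesis mu_gauss : centered_gaussian dot mu Q.

Let r : R := (Num.sqrt 2)^-1.
Let r0 : 0 < r. Proof. by rewrite invr_gt0 sqrtr_gt0. Qed.
Let rr : r * r = 2^-1. Proof. by rewrite -invfM -expr2 sqr_sqrtr. Qed.
Let r2 : r * Num.sqrt 2 = 1. Proof. by rewrite mulVf// gt_eqF// sqrtr_gt0. Qed.

(** A rotation composed with a change of sign of one component, which does not affect the norms
    compared in [gaussian_tail_rec]. *)
Definition rotation (z : borel X * borel X) : borel X * borel X :=
  (r *: ((z.1 : X) + (z.2 : X)), r *: ((z.1 : X) - (z.2 : X))).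

Lemma measurable_rotation : measurable_fun setT rotation.
Proof.
have m1 h : measurable_fun setT (fun z : borel X * borel X => dot h z.1).
  exact: (measurableT_comp (measurable_dot norm_dot h) measurable_fst).
have m2 h : measurable_fun setT (fun z : borel X * borel X => dot h z.2).
  exact: (measurableT_comp (measurable_dot norm_dot h) measurable_snd).
apply: measurable_fun_pair; apply: (measurable_into_borel norm_dot sepX) => h.
- under eq_fun do rewrite dotZr dotDr.
  by apply: measurable_funM; [exact: measurable_cst|exact: measurable_funD].
- under eq_fun do rewrite dotZr dotBr.
  by apply: measurable_funM; [exact: measurable_cst|exact: measurable_funB].
Qed.

(** Since [r * r = 1 / 2] and [Q] is symmetric, the cross terms cancel in [<Q (h + k), h + k> / 2 +
    <Q (h - k), h - k> / 2], which leaves [<Q h, h> + <Q k, k>]. *)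
Lemma gaussian_rotation E : measurable E ->
  (mu \x mu)%E (rotation @^-1` E) = (mu \x mu)%E E.
Proof.
move=> mE; have Q_lin a h k : Q (a *: h + k) = a *: Q h + Q k.
  by case: mu_gauss => -[[_ + _] _ _] _; apply.
have Q_sym h k : dot (Q h) k = dot h (Q k).
  by case: mu_gauss => -[_ + _] _; apply.
pose F : set (borel X * borel X -> R) :=
  [set f | exists h k a, f = fun z => dot h z.1 + dot k z.2 + a].
have m12 h k : measurable_fun setT (fun z : borel X * borel X => dot h z.1 + dot k z.2).
  apply: measurable_funD.
    exact: (measurableT_comp (measurable_dot norm_dot h) measurable_fst).
  exact: (measurableT_comp (measurable_dot norm_dot k) measurable_snd).
have cos12 h k a : \int[(mu \x mu)%E]_z cos (dot h z.1 + dot k z.2 + a) =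
    expR (- (dot (Q h) h / 2)) * expR (- (dot (Q k) k / 2)) * cos a.
  have [_ ->//] := cos_transform_prod
    (centered_gaussian_cos_transform norm_dot mu_gauss h)
    (centered_gaussian_cos_transform norm_dot mu_gauss k).
apply: (@fourier_law _ _ _ _ _ (mu \x mu)%E (mu \x mu)%E _ measurable_rotation F).
- by move=> _ [h [k [a ->]]]; apply: measurable_funD => //; exact: m12.
- move=> a _ _ [h [k [b ->]]] [h' [k' [b' ->]]].
  exists (a *: h + h'), (a *: k + k'), (a * b + b'); apply/funext => z.
  by rewrite !dotDl !dotZl; ring.
- by move=> c; exists 0, 0, c; apply/funext => z; rewrite !dot0l !add0r.
(* The product sigma-algebra is generated by the preimages under the two projections, so
   [borel_generated_by_dot] is applied to each factor. *)
- move=> G sG FG; have [G0 GC GU] := sG.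
  apply: smallest_sub => // A [[B mB <-]|[B mB <-]]; rewrite setTI.
  + have sG' : sigma_algebra setT [set B : set X | G (fst @^-1` B)].
      split => /=.
      - by rewrite preimage_set0.
      - by move=> C GC'; rewrite setTD preimage_setC -setTD; exact: GC.
      - by move=> C GC'; rewrite preimage_bigcup; exact: GU.
    apply: (borel_generated_by_dot norm_dot sepX sG') mB => h a /=.
    by apply: FG; exists h, 0, a; apply/funext => z; rewrite dot0l addr0.
  + have sG' : sigma_algebra setT [set B : set X | G (snd @^-1` B)].
      split => /=.
      - by rewrite preimage_set0.
      - by move=> C GC'; rewrite setTD preimage_setC -setTD; exact: GC.
      - by move=> C GC'; rewrite preimage_bigcup; exact: GU.
    apply: (borel_generated_by_dot norm_dot sepX sG') mB => h a /=.
    by apply: FG; exists 0, h, a; apply/funext => z; rewrite dot0l add0r.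
- move=> _ [h [k [a ->]]]; rewrite cos12.
  have E1 z : dot h (rotation z).1 + dot k (rotation z).2 + a =
      dot (r *: (h + k)) z.1 + dot (r *: (h - k)) z.2 + a.
    by rewrite /= !dotZr !dotZl !dotDr !dotDl !dotNr !dotNl; ring.
  under eq_Rintegral do rewrite E1.
  rewrite cos12 -!expRD; congr (expR _ * _).
  have QZ b x : Q (b *: x) = b *: Q x.
    have Q00 : Q 0 = 0 by have := Q_lin (- 1) 0 0; rewrite scaler0 addr0 scaleN1r addNr.
    by have := Q_lin b x 0; rewrite Q00 !addr0.
  have QD x y : Q (x + y) = Q x + Q y by have := Q_lin 1 x y; rewrite !scale1r.
  rewrite -(scaleN1r k) !QZ !QD !QZ !dotZl !dotZr !dotDl !dotDr !dotZl !dotZr.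
  have -> : dot (Q k) h = dot (Q h) k by rewrite Q_sym dotC.
  set x := dot (Q h) h; set y := dot (Q k) k; set w := dot (Q h) k.
  by rewrite !(mulrA r r) rr; field.
- exact: mE.
Qed.

Let mu_tail t := tail mu (fun x : borel X => `|x : X|) t.

(** If [|x + y| > sqrt 2 (s + sqrt 2 t)] and [|x - y| <= sqrt 2 s], then [2 |x|] and [2 |y|] are
    both at least [|x + y| - |x - y| > 2 t]. By invariance under [rotation] the left-hand side is
    the mass of this event. *)
Lemma gaussian_tail_rec s t :
  mu_tail (s + Num.sqrt 2 * t) * (1 - mu_tail s) <= mu_tail t ^+ 2.
Proof.
have mt := measurable_tail (@measurable_norm R X).
set t' := s + _.
have cs : mu (~` [set x : borel X | s < `|x : X|]) = (1 - mu_tail s)%:E.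
  by rewrite probability_setC// [X in (_ - X)%E](tailE mu (@measurable_norm R X) s).
have Tu u : mu [set x : borel X | u < `|x : X|] = (mu_tail u)%:E.
  exact: (tailE mu (@measurable_norm R X)).
rewrite -lee_fin expr2 !EFinM -cs -!Tu.
rewrite -!product_measure1E//; last exact: measurableC.
rewrite -gaussian_rotation; last by apply: measurableX => //; exact: measurableC.
apply: le_measure; rewrite ?inE.
- rewrite -[X in measurable X]setTI; apply: measurable_rotation => //.
  by apply: measurableX => //; exact: measurableC.
- exact: measurableX.
move=> [x y] [/= xy1 /negP]; rewrite -leNgt => xy2.
move: xy1 xy2; rewrite !normrZ (gtr0_norm r0) => xy1 xy2.
have hx : 2 * `|x : X| >= `|(x : X) + (y : X)| - `|(x : X) - (y : X)|.
  have -> : 2 * `|x : X| = `|((x : X) + (y : X)) + ((x : X) - (y : X))|.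
    by rewrite addrACA subrr addr0 -mulr2n -(scaler_nat 2 (x : X)) normrZ ger0_norm.
  by rewrite lerB_normD.
have e1 : s + Num.sqrt 2 * t < r * `|(x : X) + (y : X)| by [].
have r21 : Num.sqrt 2 * (r * `|(x : X) + (y : X)|) = `|(x : X) + (y : X)|.
  by rewrite mulrA (mulrC _ r) r2 mul1r.
have r22 : Num.sqrt 2 * (r * `|(x : X) - (y : X)|) = `|(x : X) - (y : X)|.
  by rewrite mulrA (mulrC _ r) r2 mul1r.
have q0 : 0 < Num.sqrt 2 :> R by rewrite sqrtr_gt0.
have qq : Num.sqrt 2 * (Num.sqrt 2 * t) = 2 * t by rewrite mulrA -expr2 sqr_sqrtr.
have f1 := e1; rewrite -(ltr_pM2l q0) mulrDr qq r21 in f1.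
have f2 := xy2; rewrite -(ler_pM2l q0) r22 in f2.
have hy : 2 * `|y : X| >= `|(x : X) + (y : X)| - `|(x : X) - (y : X)|.
  have -> : 2 * `|y : X| = `|((x : X) + (y : X)) - ((x : X) - (y : X))|.
    by rewrite opprB addrC addrA subrK -mulr2n -(scaler_nat 2 (y : X)) normrZ ger0_norm.
  by rewrite lerB_dist.
by split => /=; rewrite -(ltr_pM2l (ltr0Sn R 1)); lra.
Qed.

Lemma gaussian_expR_lty (c : R) : 0 <= c ->
  (\int[mu]_x (expR (c * `|x : X|))%:E < +oo)%E.
Proof.
move=> c0; have mn := @measurable_norm R X.
have e1 : expR (- 1) <= 1 :> R by rewrite -expR0 ler_expR oppr_le0.
have e0 : 0 < expR (- 1) / 2 :> R by rewrite divr_gt0 ?expR_gt0.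
(* The factor [1 / 2] makes [kappa = 1 - tail n] at least [1 / 2], so that
   [tail n <= kappa exp (- 1)]. *)
have [n n1 tn] : exists2 n : nat, (1 <= n)%N & mu_tail n%:R <= expR (- 1) / 2.
  have /cvgrPdist_le/(_ _ e0)[n _ /(_ (maxn 1 n)) h] := cvg_tail mu mn.
  exists (maxn 1 n); first exact: leq_maxl.
  have := h (leq_maxr _ _); rewrite /= sub0r normrN ger0_norm//.
  exact: tail_ge0.
apply: (@integral_expR_lty _ _ _ mu _ mn n%:R (1 - mu_tail n%:R)) => //.
- by rewrite ler1n.
- by lra.
- by move=> t; exact: gaussian_tail_rec.
- rewrite (le_trans tn)// -/(mu_tail _) mulrC ler_wpM2r ?expR_ge0//; lra.
Qed.

Lemma exp_growth_Lfun (f : X -> R) (p : R) : 1 <= p -> exp_growth f ->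
  (f : borel X -> R) \in Lfun mu p%:E.
Proof.
move=> p1 [mf [M [c [M0 c0 fM]]]].
have p0 : 0 < p by exact: lt_le_trans p1.
rewrite inE; apply/andP; split; rewrite inE//=.
rewrite /finite_norm unlock poweR_lty//.
have pc0 : 0 <= c * p by rewrite mulr_ge0// ltW.
apply: (@le_lt_trans _ _ (\int[mu]_x ((M `^ p)%:E * (expR (c * p * `|x : X|))%:E))%E).
  apply: ge0_le_integral => //=.
  - apply/measurable_EFinP; apply: (measurableT_comp (measurable_powR _)).
    exact: measurableT_comp.
  - apply: emeasurable_funM; first exact: measurable_cst.
    apply/measurable_EFinP; apply: measurableT_comp => //.
    by apply: measurable_funM; [exact: measurable_cst|exact: measurable_norm].
  - move=> x _; rewrite -EFinM lee_fin.
    have -> : expR (c * p * `|x : X|) = expR (c * `|x : X|) `^ p.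
      by rewrite -expRM mulrAC.
    rewrite -powRM ?expR_ge0 ?(ltW M0)//.
    by rewrite ge0_ler_powR ?nnegrE ?mulr_ge0 ?expR_ge0 ?(ltW M0) ?(ltW p0).
rewrite ge0_integralZl_EFin ?powR_ge0//.
  by rewrite lte_mul_pinfty ?lee_fin ?powR_ge0// gaussian_expR_lty.
apply/measurable_EFinP; apply: measurableT_comp => //.
by apply: measurable_funM; [exact: measurable_cst|exact: measurable_norm].
Qed.

End fernique.

(** * Extension of the integral formula to [L^p] *)

Theorem proposition4p10
  (R : realType) (X : completeNormedModType R) (dot : {dot X for idfun})
  (norm_dot : forall x : X, `|x| = Num.sqrt (dot x x))
  (sepX : separable X)
  (mu nu : probability (borel X) R) (Qmu Qnu : X -> X)
  (mu_gauss : centered_gaussian dot mu Qmu)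
  (nu_gauss : centered_gaussian dot nu Qnu)
  (Smu Snu : X -> X)
  (Smu_sqrt : sqrt_op (whole dot) Qmu Smu)
  (Snu_sqrt : sqrt_op (whole dot) Qnu Snu)
  (emu enu : nat -> X)
  (emu_basis : eigenbasis dot Qmu emu)
  (enu_basis : eigenbasis dot Qnu enu)
  (T : X -> X)
  (T_bounded : bounded_op (cameron_martin dot Smu) (cameron_martin dot Snu) T)
  (T_contr : (opnorm (cameron_martin dot Smu) (cameron_martin dot Snu) T <= 1)%E)
  (Tstar D : X -> X)
  (Tstar_adj : adjoint_op (cameron_martin dot Smu) (cameron_martin dot Snu)
                 T Tstar)
  (D_sqrt : sqrt_op (cameron_martin dot Smu) (fun h => h - Tstar (T h)) D)
  (A B : X -> X)
  (A_version : linear_version dot nu enu Tstar A)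
  (B_version : linear_version dot mu emu D B)
  (p : R) (p1 : (1 <= p%:E)%E) :
  exists G : LfunType mu p1 -> LfunType nu p1,
    [/\ Lp_linear G,
        Lp_opnorm G = 1%E
      & forall f : X -> R, exp_growth f ->
          exists2 F : LfunType mu p1, (F : X -> R) = f
            & G F = Gamma mu A B f %[ae nu]].
Proof.
have [_ mA _] := A_version; have [_ mB _] := B_version.
have [A' [NA [mA' mNA NA0 AA']]] := completion_measurable_fun sepX mA.
have [B' [NB [mB' mNB NB0 BB']]] := completion_measurable_fun sepX mB.
(* [A] and [B] are measurable for the completions of [nu] and [mu]; [K] is built from Borel maps
   equal to them outside null sets. *)
pose K (z : borel X * borel X) : borel X := A' z.1 + B' z.2.
have mK : measurable_fun setT K.
  apply: (measurable_into_borel norm_dot sepX) => h.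
  under eq_fun do rewrite dotDr.
  have md := measurable_dot norm_dot h.
  apply: measurable_funD.
    exact: (measurableT_comp md (measurableT_comp mA' measurable_fst)).
  exact: (measurableT_comp md (measurableT_comp mB' measurable_snd)).
have lawK : forall f : borel X -> \bar R, measurable_fun setT f ->
    (forall x, (0 <= f x)%E) -> (\int[(nu \x mu)%E]_z f (K z) = \int[mu]_x f x)%E.
  exact: (integral_Mehler norm_dot sepX mu_gauss nu_gauss Smu_sqrt Snu_sqrt
    emu_basis enu_basis T_bounded Tstar_adj D_sqrt A_version B_version
    mA' mNA NA0 AA' mB' mNB NB0 BB').
exists (transferL mK lawK (p1 := p1)); split.
- exact: transferL_linear.
- exact: transferL_opnorm.
- move=> f fE; have fL := exp_growth_Lfun norm_dot sepX mu_gauss p1 fE.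
  exists (Lfun_Sub p1 fL) => //.
  (* Off [NA] the points [A x] and [A' x] coincide, and the integrands in [y] then differ at most on
     the [mu]-null set [NB]. *)
  exists NA; split => // x /= /not_implyP[_]; apply: contra_notP => Ax.
  rewrite /transfer /Gamma /Rintegral; congr fine.
  apply: (eq_integral_off_null mNB NB0) => y By.
  by rewrite /K /= AA'// BB'.
Qed.
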